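(* Let $\mathcal{T}'(\mathbb{R})$ denote the family of all continuous maps $f\colon\mathbb{R}\to\mathbb{R}$ that are topologically transitive but not bitransitive. Then $$\inf\{\operatorname{ent}(f) : f\in\mathcal{T}'(\mathbb{R})\}=\log\sqrt{3},$$ and there is no map in $\mathcal{T}'(\mathbb{R})$ attaining this bound.
   Context: A continuous map $f\colon X\to X$ of a metric space is (topologically) transitive if for all nonempty open $U,V\subset X$ there is a positive integer $n$ with $f^n(U)\cap V\neq\emptyset$; it is bitransitive if $f^2=f\circ f$ is transitive. For a compact set $K\subset X$ with $f(K)\subset K$, $h(f|_K)\in[0,+\infty]$ denotes the usual topological entropy of $f|_K\colon K\to K$ (natural logarithm). The Cánovas–Rodríguez entropy is $\operatorname{ent}(f)=\sup\{h(f|_K) : K\subset X \text{ nonempty, compact, } f(K)\subset K\}$, with the convention $\operatorname{ent}(f)=\infty$ if there is no such $K$. *)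

(* Defs.v *)
From HB Require Import structures.
From mathcomp Require Import all_boot all_order all_algebra.
From mathcomp Require Import finmap.
From mathcomp Require Import all_classical all_reals all_analysis.

Set Implicit Arguments.
Unset Strict Implicit.
Unset Printing Implicit Defensive.

Import Order.TTheory GRing.Theory Num.Theory.
Import numFieldNormedType.Exports.

Local Open Scope classical_set_scope.
Local Open Scope ring_scope.

Definition transitive_map (X : topologicalType) (f : X -> X) : Prop :=
  forall U V : set X, open U -> open V -> U !=set0 -> V !=set0 ->
    exists2 n : nat, (0 < n)%N & (iter n f @` U) `&` V !=set0.

Definition bitransitive_map (X : topologicalType) (f : X -> X) : Prop :=
  transitive_map (f \o f).

Section Entropy.
Variables (R : realType) (X : metricType R).
Implicit Types (f : X -> X) (K : set X) (E : {fset X}) (n : nat) (e : R).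

Definition bowen_dist f n (x y : X) : R :=
  \big[Num.max/0]_(i < n) mdist (iter i f x) (iter i f y).

Definition bowen_separated f n e E : Prop :=
  {in E &, forall x y, x != y -> e < bowen_dist f n x y}.

Local Open Scope ereal_scope.

Definition max_separated f K n e : \bar R :=
  ereal_sup [set (#|` E|%:R)%:E | E in
    [set E : {fset X} | [set` E] `<=` K /\ bowen_separated f n e E]].

(* Topological entropy of f|_K by Bowen's formula; it is meaningful for K
   nonempty, compact and f-invariant. The growth rate is nonincreasing in e, so
   the supremum over e > 0 is its limit as e tends to 0 from the right. *)
Definition htop f K : \bar R :=
  ereal_sup [set limn_esup (fun n => (n%:R^-1)%:E * lne (max_separated f K n e))
            | e in [set e : R | (0 < e)%R]].

Definition invariant_compact f : set (set X) :=
  [set K | [/\ K !=set0, compact K & f @` K `<=` K]].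

Definition CR_entropy f : \bar R :=
  if `[< invariant_compact f !=set0 >]
  then ereal_sup [set htop f K | K in invariant_compact f]
  else +oo.

End Entropy.

(* The regular module R^o is the line R as a metric space. *)
Lemma mdist_lineE (R : realType) (x y : R) : @mdist R R^o x y = `|y - x|.
Proof. by []. Qed.

Definition line_entropy (R : realType) (f : R -> R) : \bar R :=
  @CR_entropy R R^o f.

Definition T'_line (R : realType) : set (R -> R) :=
  [set f | [/\ continuous f, transitive_map f & ~ bitransitive_map f]].
Arguments T'_line R : clear implicits.

(* Main.v *)
Require Import Defs.
From mathcomp Require Import all_boot all_order all_algebra.
From mathcomp Require Import all_classical all_reals all_analysis.
From mathcomp Require Import finmap ring lra zify.

(* Lower bound. If f is transitive but f^2 is not, f has a fixed point z and
   exchanges the two half-lines at z; so g = f^2 is transitive on [z, +oo[, where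
   its fixed points are unbounded and none of the segments [z, d], nor of the
   half-lines [a, +oo[ with a > z, is invariant. A leftmost choice then yields
   fixed points a < d and points a < x < y < d with g x > d and g y < a, a
   3-horseshoe of g on [a, d]. By transitivity the part of [a, d] sent beyond d is
   eventually mapped over [a, d] again, so for some m the iterate g^m = f^(2m) has
   3^m + 1 branches on [a, d] and ent f >= ln (3^m + 1) / (2m) > ln 3 / 2.

   Upper bound. For L > 3 there is an odd zigzag map G of slopes L and -L with
   three laps over each [k, k + 1], which slightly overflow this interval, so that
   G is transitive. The map equal to -|G| on [0, +oo[ and to x |-> -x on ]-oo, 0]
   is transitive, exchanges the half-lines at 0, and its n-th iterate has Lipschitz
   constant L^ceil(n/2), whence ent <= ln L / 2. *)

Set Implicit Arguments.
Unset Strict Implicit.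
Unset Printing Implicit Defensive.

Import Order.TTheory GRing.Theory Num.Theory.
Import numFieldNormedType.Exports.

Local Open Scope classical_set_scope.
Local Open Scope ring_scope.

(** * Entropy estimates *)

Section EntropyEstimates.
Local Open Scope ereal_scope.

Lemma limn_esup_ge_freq (R : realType) (u : nat -> \bar R) (l : \bar R) :
  (forall N, exists2 n, (N <= n)%N & l <= u n) -> l <= limn_esup u.
Proof.
move=> ul; apply: le_ereal_inf_tmp => _ [V [N _ NV] <-].
have [n Nn lun] := ul N; apply: le_trans lun _.
by apply: ereal_sup_ubound; exists n => //; exact: NV.
Qed.

Lemma limn_esup_le_near (R : realType) (u : nat -> \bar R) (l : \bar R) :
  (forall e : R, (0 < e)%R -> exists N, forall n, (N <= n)%N -> u n <= l + e%:E) ->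
  limn_esup u <= l.
Proof.
move=> ul; apply/lee_addgt0Pr => e e0; have [N uN] := ul _ e0.
apply: (@le_trans _ _ (ereal_sup (u @` [set n | (N <= n)%N]))).
  apply: ereal_inf_lbound; exists [set n | (N <= n)%N] => //.
  by exists N.
by apply: ge_ereal_sup => _ [n /= Nn <-]; exact: uN.
Qed.

(** One scale and one subsequence suffice: the entropy is a supremum over scales, and an upper limit
    only needs a lower bound at the multiples of [k]. *)
Lemma htop_ge (R : realType) (X : metricType R) (f : X -> X) (K : set X)
    (e : R) (r k : nat) :
  (0 < e)%R -> (0 < k)%N -> (0 < r)%N ->
  (forall n, exists E : {fset X},
    [/\ [set` E] `<=` K, bowen_separated f (n * k) e E & (r ^ n <= #|` E|)%N]) ->
  (ln r%:R / k%:R)%:E <= htop f K.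
Proof.
move=> e0 k0 r0 sepE; apply: ereal_sup_ge; eexists; first by exists e.
apply: limn_esup_ge_freq => N; exists (N.+1 * k)%N.
  by rewrite (leq_trans (leqnSn N))// leq_pmulr.
have [E [EK Esep rE]] := sepE N.+1.
have rN0 : (0 < (r ^ N.+1)%:R :> R)%R by rewrite ltr0n expn_gt0 r0.
have : (ln (r ^ N.+1)%:R)%:E <= lne (max_separated f K (N.+1 * k) e).
  have rM : (r ^ N.+1)%:R%:E <= max_separated f K (N.+1 * k) e.
    by apply: ereal_sup_ge; exists (#|` E|%:R)%:E; [exists E|rewrite lee_fin ler_nat].
  rewrite -lne_EFin// lee_lne// in_itv/= leey andbT; first by rewrite lee_fin ltW.
  by apply: le_trans rM; rewrite lee_fin ltW.
have k0' : (0 <= (N.+1 * k)%:R^-1 :> R)%R by rewrite invr_ge0.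
move=> /(@lee_wpmul2l _ ((N.+1 * k)%:R^-1)%:E)-/(_ k0'); apply: le_trans.
rewrite -EFinM lee_fin natrX lnXn ?ltr0n// -(mulr_natl (ln _)) natrM.
rewrite le_eqVlt; apply/orP; left; apply/eqP.
by rewrite invfM mulrACA mulVf ?pnatr_eq0// mul1r mulrC.
Qed.

(** Pigeonhole: each cell of length [s], counted from [- M], contains at most one point of [E]. *)
Lemma card_separated_segment (R : realType) (M s : R) (E : {fset R}) :
  (0 <= M)%R -> (0 < s)%R -> {in E, forall x, `|x| <= M}%R ->
  {in E &, forall x y, x != y -> s < `|y - x|}%R ->
  (#|` E|%:R <= 2 * M / s + 1 :> R)%R.
Proof.
move=> M0 s0 EM Es; pose h (x : R) := `|Num.floor ((x + M) / s)%R|%N.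
have hE x : x \in E -> ((h x)%:R <= (x + M) / s < (h x)%:R + 1)%R.
  move=> /EM; rewrite ler_norml => /andP[xM _].
  have x0 : (0 <= (x + M) / s)%R by apply: divr_ge0; [lra|exact: ltW].
  have f0 : (0 <= Num.floor ((x + M) / s))%R by rewrite floor_ge0.
  by have := floor_itv ((x + M) / s)%R; rewrite intrD /h natr_absz ger0_norm.
pose N := `|Num.floor (2 * M / s)%R|%N.
have N0 : (0 <= 2 * M / s)%R by apply: divr_ge0; [lra|exact: ltW].
have NE : (N%:R <= 2 * M / s < N%:R + 1)%R.
  have f0 : (0 <= Num.floor (2 * M / s))%R by rewrite floor_ge0.
  by have := floor_itv (2 * M / s)%R; rewrite intrD /N natr_absz ger0_norm.
have hN (x : E) : (h (val x) < N.+1)%N.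
  have /andP[h1 _] := hE _ (valP x); case/andP: NE => _ N2.
  rewrite ltnS -ltnS -(@ltr_nat R) (le_lt_trans h1)// -[X in (_ < X)%R]natr1.
  apply: le_lt_trans N2.
  rewrite ler_pM2r ?invr_gt0// mulr_natl mulr2n lerD2r.
  by have := EM _ (valP x); rewrite ler_norml => /andP[].
have h_inj : injective (fun x : E => Ordinal (hN x)).
  move=> x y [hxy]; apply: val_inj; apply/eqP; apply: contraT => xy.
  have /andP[x1 x2] := hE _ (valP x); have /andP[y1 y2] := hE _ (valP y).
  have := Es _ _ (valP x) (valP y) xy; rewrite ltNge => /negP; case.
  move: x1 x2 y1 y2; rewrite hxy !ler_pdivlMr// !ltr_pdivrMr// => x1 x2 y1 y2.
  by rewrite ler_norml; apply/andP; split; lra.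
have := leq_card _ h_inj; rewrite card_ord -cardfE -(@ler_nat R) => /le_trans -> //.
by rewrite -natr1 lerD2r; case/andP: NE.
Qed.

Lemma max_separated_ge0 (R : realType) (X : metricType R) (f : X -> X) (K : set X)
    (n : nat) (e : R) : 0 <= max_separated f K n e.
Proof.
apply: ereal_sup_ubound; exists fset0; last by rewrite cardfs0.
by split => [x|x y]; rewrite ?inE //= inE.
Qed.

(** Bowen separation at time [n] and scale [e] implies separation at scale [e / L ^+ n./2] for the
    usual distance, which bounds cardinalities by a constant times [L ^+ n./2]. *)
Lemma htop_line_le (R : realType) (f : R -> R) (K : set R) (L : R) :
  (1 < L)%R -> compact K ->
  (forall n x y, `|iter n f x - iter n f y| <= L ^+ uphalf n * `|x - y|)%R ->
  @htop R R^o f K <= (ln L / 2)%:E.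
Proof.
move=> L1 cK fL; have L0 : (0 < L)%R by apply: lt_trans L1.
have [M [M0 KM]] : exists M : R, (0 <= M)%R /\ forall x, K x -> (`|x| <= M)%R.
  have [M [_ KM]] := @compact_bounded R R^o K cK.
  exists (`|M| + 1)%R; split; first by rewrite addr_ge0.
  by apply: KM; rewrite (le_lt_trans (ler_norm M))// ltrDl.
apply: ge_ereal_sup => _ [e /= e0 <-].
pose C := (2 * M / e + 1)%R.
have C1 : (1 <= C)%R by rewrite lerDr !mulr_ge0 ?invr_ge0// ltW.
have maxC n : @max_separated R R^o f K n e <= (C * L ^+ n./2)%:E.
  apply: ge_ereal_sup => _ [E [EK Esep] <-]; rewrite lee_fin.
  have Ln : (0 < L ^+ n./2)%R by rewrite exprn_gt0.
  apply: le_trans (@card_separated_segment R M (e / L ^+ n./2) E M0 _ _ _) _.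
  - by rewrite divr_gt0.
  - by move=> x xE; apply/KM/EK.
  - move=> x y xE yE xy; rewrite ltr_pdivrMr// mulrC.
    apply: lt_le_trans (Esep _ _ xE yE xy) _.
    apply: bigmax_le => [|i _]; first by rewrite mulr_ge0// ltW.
    rewrite mdist_lineE distrC; apply: le_trans (fL i x y) _.
    rewrite distrC ler_wpM2r// ler_weXn2l ?(ltW L1)//.
    (* Only times [i < n] occur, and then [uphalf i <= n./2]. *)
    by rewrite uphalfE half_leq.
  - have L1n : (1 <= L ^+ n./2)%R by rewrite exprn_ege1// ltW.
    by rewrite invfM invrK mulrA /C; lra.
apply: limn_esup_le_near => d d0.
have lnC0 : (0 <= ln C)%R by rewrite ln_ge0.
exists (Num.bound (ln C / d)).+1 => n Nn.
have n0 : (0 < n%:R :> R)%R by rewrite ltr0n (leq_trans _ Nn).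
have Cn : (ln C / n%:R <= d)%R.
  rewrite ler_pdivrMr// mulrC -ler_pdivrMr//.
  have /archi_boundP/ltW/le_trans -> // : (0 <= ln C / d)%R by rewrite divr_ge0// ltW.
  by rewrite ler_nat ltnW.
have CL0 : (0 < C * L ^+ n./2)%R by rewrite mulr_gt0 ?exprn_gt0// (lt_le_trans _ C1).
have n0' : (0 <= n%:R^-1 :> R)%R by rewrite invr_ge0 ltW.
apply: (@le_trans _ _ ((n%:R^-1)%:E * lne (C * L ^+ n./2)%:E)).
  apply: lee_wpmul2l => //; rewrite lee_lne// in_itv/= leey andbT.
    exact: max_separated_ge0.
  by rewrite lee_fin ltW.
rewrite lne_EFin// -EFinM -EFinD lee_fin lnM ?posrE ?exprn_gt0 ?(lt_le_trans _ C1)//.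
rewrite lnXn// mulrDr addrC lerD//; last by rewrite mulrC.
rewrite mulrC ler_pdivrMr// mulrAC -(mulr_natr (ln L)) -mulrA.
apply: ler_wpM2l; first by rewrite ln_ge0// ltW.
rewrite ler_pdivlMr// -natrM ler_nat muln2.
by rewrite -[leqRHS]odd_double_half leq_addl.
Qed.

End EntropyEstimates.

(** * Transitive maps of the line *)

Section LineDynamics.
Variable R : realType.
Implicit Types (f : R -> R) (a b c d x y z p : R).

Definition interval_transitive f : Prop := forall a b c d, a < b -> c < d ->
  exists n x, [/\ (0 < n)%N, a < x < b & c < iter n f x < d].

Lemma open_contains_interval (U : set R) : open U -> U !=set0 ->
  exists a b, a < b /\ forall x, a < x < b -> U x.
Proof.
move=> oU [x Ux]; have /nbhs_ballP[e /= e0 xeU] := open_nbhs_nbhs (conj oU Ux).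
exists (x - e), (x + e); split; first by lra.
by move=> y xy; apply: xeU; rewrite /ball/= distrC ltr_norml; lra.
Qed.

Lemma interval_open a b : open [set x | a < x < b].
Proof. by have := @itv_open _ R a b; rewrite set_itvE. Qed.

Lemma transitive_lineP f : transitive_map f <-> interval_transitive f.
Proof.
split=> tf.
  move=> a b c d ab cd.
  have [||n n0 [_ [[x xab <-] xcd]]] := tf _ _ (@interval_open a b) (@interval_open c d).
  - by exists ((a + b) / 2) => /=; lra.
  - by exists ((c + d) / 2) => /=; lra.
  by exists n, x.
move=> U V oU oV /(open_contains_interval oU)[a [b [ab abU]]].
move=> /(open_contains_interval oV)[c [d [cd cdV]]].
have [n [x [n0 xab xcd]]] := tf _ _ _ _ ab cd.
by exists n => //; exists (iter n f x); split; [exists x => //; exact: abU|exact: cdV].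
Qed.

Lemma ivt_le f a b v : continuous f -> a <= b ->
  (f a <= v <= f b \/ f b <= v <= f a) -> exists2 c, a <= c <= b & f c = v.
Proof.
move=> cf ab fab.
have /(_ ab)[||c] := @IVT R f a b v.
- exact: continuous_subspaceT.
- by case: fab => /andP[h1 h2]; rewrite ge_min le_max h1 h2 ?orbT.
- by rewrite in_itv; exists c.
Qed.

Lemma ivt f p q v : continuous f -> f p <= v <= f q ->
  exists2 c, (p <= c <= q) || (q <= c <= p) & f c = v.
Proof.
move=> cf fpq; have [pq|/ltW qp] := leP p q.
  by have [|c cpq fc] := @ivt_le f p q v cf pq; [left|exists c => //; rewrite cpq].
have [|c cpq fc] := @ivt_le f q p v cf qp; first by right.
by exists c => //; rewrite cpq orbT.
Qed.

Lemma continuous_iter f n : continuous f -> continuous (iter n f).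
Proof.
move=> cf; elim: n => [|n IHn] x /=; first exact: cvg_id.
exact: continuous_comp (IHn x) (cf _).
Qed.

Lemma continuous_itv f x c d : continuous f -> c < f x < d ->
  exists2 e, 0 < e & forall y, x - e < y < x + e -> c < f y < d.
Proof.
move=> cf xcd.
have : nbhs (f x) [set y | c < y < d].
  by apply: open_nbhs_nbhs; split => //; exact: interval_open.
move=> /(cf x) /nbhs_ballP[e /= e0 xe]; exists e => // y xy; apply: xe.
by rewrite /ball/= distrC ltr_norml; lra.
Qed.

Section Transitive.
Variable f : R -> R.
Hypotheses (cf : continuous f) (tf : interval_transitive f).

(** The main source of contradictions: an invariant set that contains an interval cannot avoid
    another one. *)
Lemma invariant_dense (P : R -> Prop) a b c d : (forall x, P x -> P (f x)) ->
  a < b -> (forall x, a < x < b -> P x) -> c < d -> exists2 y, c < y < d & P y.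
Proof.
move=> Pf ab abP cd; have [n [x [_ xab xcd]]] := tf ab cd.
by exists (iter n f x) => //; elim: n {xcd} => [|n IHn]; [exact: abP|exact: Pf].
Qed.

Lemma transitive_surj y : exists x, f x = y.
Proof.
have hit c d : c < d -> exists x, c < f x < d.
  move=> cd; have [[|n] [x [n0 _ xcd]]] := tf ltr01 cd; first by [].
  by exists (iter n f x).
have [p pl] : exists x, y - 1 < f x < y by apply: hit; lra.
have [q ql] : exists x, y < f x < y + 1 by apply: hit; lra.
have [|x _ fx] := @ivt f p q y cf; first by lra.
by exists x.
Qed.

Lemma transitive_surj_iter n y : exists x, iter n f x = y.
Proof.
elim: n y => [|n IHn] y; first by exists y.
by have [x <-] := transitive_surj y; have [w <-] := IHn x; exists w.
Qed.

(** By surjectivity the [N]-th iterate maps some open interval into []c, d[]; it suffices to reach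
    that interval. *)
Lemma transitive_late N a b c d : a < b -> c < d ->
  exists n x, [/\ (N <= n)%N, a < x < b & c < iter n f x < d].
Proof.
move=> ab cd; have [w wcd] := transitive_surj_iter N ((c + d) / 2).
have [|e e0 we] := @continuous_itv (iter N f) w c d (@continuous_iter f N cf).
  by rewrite wcd; lra.
have [|n [x [_ xab xw]]] := @tf a b (w - e) (w + e) ab; first by lra.
exists (N + n)%N, x; split => //; first exact: leq_addr.
by rewrite iterD; exact: we.
Qed.

Lemma transitive_not_up b : exists2 x, b <= x & f x < b.
Proof.
apply: contrapT => h.
have [||||y ycd Py] := @invariant_dense (fun x => b <= x) b (b + 1) (b - 1) b; try by move=> *; lra.
move=> x bx; rewrite leNgt; apply/negP => fx; apply: h; by exists x.
Qed.

Lemma transitive_not_down b : exists2 x, x <= b & b < f x.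
Proof.
apply: contrapT => h.
have [||||y ycd Py] := @invariant_dense (fun x => x <= b) (b - 1) b b (b + 1); try by move=> *; lra.
move=> x bx; rewrite leNgt; apply/negP => fx; apply: h; by exists x.
Qed.

Lemma transitive_fixpoint : exists z, f z = z.
Proof.
have [x x0 fx] := transitive_not_up 0; have [y y0 fy] := transitive_not_down 0.
have [||z _ fz] := @ivt (fun x => f x - x) x y 0; last by exists z; lra.
  by move=> t; apply: cvgB; [exact: cf|exact: cvg_id].
lra.
Qed.

End Transitive.

(** The inequalities are weak because points other than [z] may be mapped to [z]. *)
Definition swaps f z : Prop :=
  [/\ f z = z, forall x, z <= x -> f x <= z & forall x, x <= z -> z <= f x].

(** By the intermediate value theorem each open half-line at [z] goes entirely to one side;
    transitivity forbids that it goes into itself. *)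
Lemma total_preimage_swaps f z : continuous f -> interval_transitive f ->
  f z = z -> (forall x, f x = z -> x = z) -> swaps f z.
Proof.
move=> cf tf fz zP.
suff [h1 h2] : (forall x, z < x -> f x < z) /\ (forall x, x < z -> z < f x).
  split=> // x; rewrite le_eqVlt.
    by move=> /predU1P[<-|/h1/ltW//]; rewrite fz.
  by move=> /predU1P[->|/h2/ltW//]; rewrite fz.
split=> x xz; rewrite ltNge; apply/negP => fx.
  have fx' : z < f x.
    by rewrite lt_neqAle fx andbT; apply/eqP => /esym/zP xz'; move: xz; rewrite xz' ltxx.
  have [||||y ycd Py] := @invariant_dense _ tf (fun x => z < x) z (z + 1) (z - 1) z;
    try by move=> *; lra.
  move=> y zy; rewrite ltNge; apply/negP => fy.
  have [|w wxy /zP wz] := @ivt f y x z cf; first by lra.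
  lra.
have fx' : f x < z.
  by rewrite lt_neqAle fx andbT; apply/eqP => /zP xz'; move: xz; rewrite xz' ltxx.
have [||||y ycd Py] := @invariant_dense _ tf (fun x => x < z) (z - 1) z z (z + 1);
  try by move=> *; lra.
move=> y zy; rewrite ltNge; apply/negP => fy.
have [|w wxy /zP wz] := @ivt f x y z cf; first by lra.
lra.
Qed.

End LineDynamics.

(** * Orbits of intervals and exchange of half-lines *)

Section Structure.
Variable R : realType.
Implicit Types (f : R -> R) (a b c d x y z p : R).

Lemma common_radius (Q : nat -> R -> Prop) n :
  (forall j e e', e' <= e -> Q j e -> Q j e') ->
  (forall j, (j < n)%N -> exists2 e, 0 < e & Q j e) ->
  exists2 e, 0 < e & forall j, (j < n)%N -> Q j e.
Proof.
move=> Qle; elim: n => [|n IHn] Qn; first by exists 1.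
have [e e0 eQ] := IHn (fun j jn => Qn j (ltnW jn)).
have [e' e'0 e'Q] := Qn n (ltnSn n).
exists (Num.min e e'); first by rewrite lt_min e0 e'0.
move=> j; rewrite ltnS leq_eqVlt => /predU1P[->|jn].
  by apply: Qle e'Q; rewrite ge_min lexx orbT.
by apply: Qle (eQ _ jn); rewrite ge_min lexx.
Qed.

(* If f^n(]a, b[) meets ]a, b[, the orbit of ]a, b[ is a union of n intervals.
   A backward orbit of z that it avoids lies in the finite set of their end
   points, yet it is infinite, since it contains u <> z with f u = z. *)
Lemma orbit_hits_fixpoint f z u a b : continuous f -> interval_transitive f ->
  f z = z -> f u = z -> u != z -> a < b ->
  exists n x, a < x < b /\ iter n f x = z.
Proof.
move=> cf tf fz fu uz ab; apply: contrapT => nohit.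
have [n [x0 [n0 x0ab x0n]]] := tf a b a b ab ab.
have [s fs] := choice (transitive_surj cf tf).
pose v k := iter k s u.
have fv k : iter k f (v k) = u.
  by elim: k => [//|k IHk]; rewrite iterSr /= fs.
have fvD k m : iter k f (v (k + m)%N) = v m.
  elim: k => [//|k IHk]; rewrite iterSr addSn /= fs; exact: IHk.
have fzi k : iter k f z = z by elim: k => //= k ->.
have v_inj : injective v.
  suff vlt i j : (i < j)%N -> v i <> v j.
    by move=> i j vij; case: (ltngtP i j) => // /vlt; rewrite vij.
  move=> ij vij; have := fv i; rewrite vij -(subnKC (ltnW ij)) fvD => vu.
  move: ij; rewrite -subn_gt0; case: (j - i)%N vu => // m vu _.
  have := fv m.+1; rewrite vu iterSr fu fzi => /esym/eqP; exact/negP.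
have bad k m x : a < x < b -> iter m f x != v k.
  move=> xab; apply/eqP => xv; apply: nohit; exists (k.+1 + m)%N, x; split=> //.
  by rewrite iterD xv /= fv.
have side k m x x' : a < x < b -> a < x' < b -> iter m f x < v k -> iter m f x' < v k.
  move=> xab xab' xv; rewrite ltNge; apply/negP => xv'.
  have [|w wxx' /eqP] := @ivt _ (iter m f) x x' (v k) (@continuous_iter _ f m cf).
    by rewrite ltW.
  by apply/negP/bad; lra.
(* Successive images forming [T j] meet, because [x0] and its [n]-th iterate lie in []a, b[]; hence
   [T j] stays on one side of each [v k]. *)
pose T j : set R := [set y | exists m x, a < x < b /\ y = iter (j + m * n) f x].
have Tside k j y : T j y -> (y < v k) = (iter j f x0 < v k).
  move=> [m [x [xab ->]]].
  have sideE i x1 x2 : a < x1 < b -> a < x2 < b ->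
      (iter i f x1 < v k) = (iter i f x2 < v k).
    by move=> h1 h2; apply/idP/idP; apply: side.
  elim: m x xab => [|m IHm] x xab; first by rewrite mul0n addn0; exact: sideE.
  rewrite (sideE _ _ x0)// mulSn addnCA addnC iterD.
  exact: IHm.
have Tadh k : exists2 j, (j < n)%N & forall e, 0 < e -> exists2 y, T j y & `|y - v k| < e.
  apply: contrapT => h.
  have [| |e e0 Te] := @common_radius (fun j e => forall y, T j y -> e <= `|y - v k|) n.
  - by move=> j e e' ee' jQ y /jQ; exact: le_trans.
  - move=> j jn; apply: contrapT => h'; apply: h; exists j => // e e0.
    apply: contrapT => h''; apply: h'; exists e => // y jy; rewrite leNgt.
    by apply/negP => ye; apply: h''; exists y.
  have [|m [x [_ xab xe]]] := tf a b (v k - e) (v k + e) ab; first by lra.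
  have := Te (m %% n)%N (ltn_pmod m n0) (iter m f x); rewrite leNgt => /(_ _)/negP; apply.
    by exists (m %/ n)%N, x; rewrite addnC -divn_eq.
  by rewrite ltr_norml; lra.
(* Adherent to some [T j] that lies on one side of it, [v k] is an end point of [T j]; there are
   only [2 n] of these. *)
pose G (jb : 'I_n * bool) := if jb.2 then sup (T jb.1) else inf (T jb.1).
have vG k : exists jb, v k = G jb.
  have [j jn jv] := Tadh k.
  have Tj0 : T j (iter j f x0) by exists 0%N, x0; rewrite mul0n addn0.
  exists (Ordinal jn, iter j f x0 < v k); rewrite /G /=; case: ifPn => jx.
    have ub : ubound (T j) (v k) by move=> y jy; rewrite ltW// (Tside k j y jy).
    apply/eqP; rewrite eq_le; apply/andP; split; last by apply: ge_sup => //; exists (iter j f x0).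
    apply/ler_addgt0Pr => e e0; have [y jy] := jv _ e0; rewrite ltr_norml => /andP[ye _].
    have : y <= sup (T j) by apply: ub_le_sup => //; exists (v k).
    by lra.
  have lb : lbound (T j) (v k) by move=> y jy; rewrite leNgt (Tside k j y jy).
  apply/eqP; rewrite eq_le; apply/andP; split.
    by apply: lb_le_inf => //; exists (iter j f x0).
  apply/ler_addgt0Pr => e e0; have [y jy] := jv _ e0; rewrite ltr_norml => /andP[_ ye].
  have : inf (T j) <= y by apply: ge_inf => //; exists (v k).
  by lra.
have [F vF] := choice vG.
have F_inj : injective (fun i : 'I_(n * 2).+1 => F i).
  by move=> i j Fij; apply/val_inj/v_inj; rewrite !vF Fij.
by have := leq_card _ F_inj; rewrite card_prod !card_ord card_bool ltnn.
Qed.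

(* E and O are intervals around z exchanged by f. Their intersection is invariant
   and bounded, hence reduced to z. *)
Lemma cover_swaps f z (E O : R -> Prop) v :
  (forall P : R -> Prop, (forall x, P x -> P (f x)) -> forall a b, a < b ->
    (forall x, a < x < b -> P x) -> forall c d, c < d -> exists2 y, c < y < d & P y) ->
  (forall y, exists x, f x = y) -> f z = z ->
  (forall y, E y \/ O y) -> (forall x, E x -> O (f x)) -> (forall x, O x -> E (f x)) ->
  (forall y t, E y -> (y <= t <= z \/ z <= t <= y) -> E t) ->
  (forall y t, O y -> (y <= t <= z \/ z <= t <= y) -> O t) ->
  z < v -> ~ E v -> swaps f z.
Proof.
move=> dense surj fz EO fE fO convE convO zv Ev.
have Ov : O v by case: (EO v).
have [w Ow] : exists w, ~ O w.
  apply: contrapT => h; apply: Ev; have [x <-] := surj v; apply: fO.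
  by apply: contrapT => Ox; apply: h; exists x.
have Ew : E w by case: (EO w).
have wz : w < z by rewrite ltNge; apply/negP => zw; apply: Ow; case: (leP w v) => wv;
   [apply: convO Ov _; right; lra|exfalso; apply: Ev; apply: convE Ew _; right; lra].
have meet t : E t -> O t -> t = z.
  move=> Et Ot; apply/eqP; apply: contrapT => /negP tz.
  pose P x := E x /\ O x.
  have fP x : P x -> P (f x) by move=> [Ex Ox]; split; [exact: fO|exact: fE].
  have vP y : P y -> y < v.
    move=> [Ey _]; rewrite ltNge; apply/negP => vy; apply/Ev/(convE _ _ Ey).
    by right; lra.
  have [y yv Py] : exists2 y, v < y < v + 1 & P y.
    have [tz'|zt|tz'] := ltgtP t z; last by rewrite tz' eqxx in tz.
      apply: (dense P fP t z) => //; last by lra.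
      by move=> x tx; split; [apply: convE Et _|apply: convO Ot _]; left; lra.
    apply: (dense P fP z t) => //; last by lra.
    by move=> x tx; split; [apply: convE Et _|apply: convO Ot _]; right; lra.
  by have := vP _ Py; lra.
have Ele y : E y -> y <= z.
  move=> Ey; rewrite leNgt; apply/negP => zy; have [yv|vy] := leP y v.
    have : y = z by apply: meet => //; apply: convO Ov _; right; lra.
    lra.
  by apply: Ev; apply: convE Ey _; right; lra.
have Oge y : O y -> z <= y.
  move=> Oy; rewrite leNgt; apply/negP => zy; have [wy|yw] := leP w y.
    have : y = z by apply: meet => //; apply: convE Ew _; left; lra.
    lra.
  by apply: Ow; apply: convO Oy _; left; lra.
split=> // x.
  rewrite le_eqVlt => /predU1P[<-|zx]; first by rewrite fz.
  by apply: (Ele _ (@fO _ _)); case: (EO x) => // /(Ele _); lra.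
rewrite le_eqVlt => /predU1P[->|zx]; first by rewrite fz.
by apply: (Oge _ (@fE _ _)); case: (EO x) => // /(Oge _); lra.
Qed.

Lemma swaps_opp f z : swaps (fun x => - f (- x)) (- z) -> swaps f z.
Proof.
move=> [fz h1 h2]; split; first by move: fz; rewrite opprK; lra.
  by move=> x zx; have := h2 (- x); rewrite opprK; lra.
by move=> x zx; have := h1 (- x); rewrite opprK; lra.
Qed.

Lemma iter_comp2 f n x : iter n (f \o f) x = iter n.*2 f x.
Proof. by elim: n => //= n ->. Qed.

(** If [z] has another preimage, an interval []a, b[] whose even iterates miss []c, d[] still
    reaches [z]. Its late iterates of each parity form two intervals around [z], exchanged by [f]
    and covering the line, and the even one misses []c, d[]: [cover_swaps] applies. *)
Lemma not_bitransitive_swaps f : continuous f -> transitive_map f ->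
  ~ bitransitive_map f -> exists z, swaps f z.
Proof.
move=> cf /transitive_lineP tf; rewrite /bitransitive_map transitive_lineP => ntf.
have [z fz] := transitive_fixpoint cf tf.
have [zP|] := pselect (forall x, f x = z -> x = z).
  by exists z; exact: total_preimage_swaps.
move=> /existsNP[u /not_implyP[fu /eqP uz]].
have [a [b [c [d [ab [cd abcd]]]]]] : exists a b c d, a < b /\ c < d /\
    forall n x, (0 < n)%N -> a < x < b -> ~ (c < iter n.*2 f x < d).
  apply: contrapT => h; apply: ntf => a b c d ab cd.
  apply: contrapT => h'; apply: h; exists a, b, c, d; do 2!split=> //.
  by move=> n x n0 xab xcd; apply: h'; exists n, x; rewrite iter_comp2.
have [n [x1 [x1ab x1n]]] := orbit_hits_fixpoint cf tf fz fu uz ab.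
have iterz m : iter m f z = z by elim: m => //= m ->.
(* i is the parity of the iterates collected in E i. *)
pose E i y := exists m x, a < x < b /\ y = iter (n.+1 + m).*2 f (iter i f x).
(* The offset [n.+1] makes all times at least [n], from which on the orbit of [x1] is at [z]; so
   every collected iterate contains [z]. *)
have Ez i : E i z.
  exists 0%N, x1; split=> //; rewrite -iterD.
  have -> : ((n.+1 + 0).*2 + i = (n.+1 + 1 + i) + n)%N by clear; lia.
  by rewrite iterD x1n iterz.
have Econv i y t : E i y -> (y <= t <= z \/ z <= t <= y) -> E i t.
  move=> [m [x [xab ->]]]; rewrite -iterD => yt.
  have : iter ((n.+1 + m).*2 + i) f x1 = z.
    have -> : ((n.+1 + m).*2 + i = (n.+1 + m + 1 + m + i) + n)%N by clear; lia.
    by rewrite iterD x1n iterz.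
  set g := iter _ f => gx1.
  have cg : continuous g by exact: continuous_iter.
  have [w wx gw] : exists2 w, (x <= w <= x1) || (x1 <= w <= x) & g w = t.
    case: yt => yt.
      by apply: (ivt cg); rewrite gx1.
    by have [|w wx gw] := @ivt _ g x1 x t cg; [rewrite gx1|exists w => //; rewrite orbC].
  exists m, w; split; first by lra.
  by rewrite -iterD -gw.
have f01 x : E 0%N x -> E 1%N (f x).
  by move=> [m [y [yab ->]]]; exists m, y; split=> //; rewrite /= -iterS iterSr.
have f10 x : E 1%N x -> E 0%N (f x).
  move=> [m [y [yab ->]]]; exists m.+1, y; split=> //.
  by rewrite addnS doubleS /= -iterSr.
(* The union is dense, as intervals are reached at arbitrarily late times; being star-shaped around
   [z], it is everything. *)
have E01 y : E 0%N y \/ E 1%N y.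
  have Edense s t : s < t -> exists2 y, s < y < t & E 0%N y \/ E 1%N y.
    move=> st; have [m [x [nm xab xst]]] := transitive_late cf tf (n.+1).*2 ab st.
    exists (iter m f x) => //.
    have mE : (m = (n.+1 + (m./2 - n.+1)).*2 + odd m)%N.
      rewrite subnKC; first by rewrite addnC odd_double_half.
      by rewrite -(doubleK n.+1) half_leq.
    rewrite mE iterD; case: (odd m); [right|left];
    by exists (m./2 - n.+1)%N, x.
  have [zy|yz] := leP z y.
    have [|y' yy' [Ey'|Ey']] := Edense y (y + 1); first by lra.
      by left; apply: Econv Ey' _; right; lra.
    by right; apply: Econv Ey' _; right; lra.
  have [|y' yy' [Ey'|Ey']] := Edense (y - 1) y; first by lra.
    by left; apply: Econv Ey' _; left; lra.
  by right; apply: Econv Ey' _; left; lra.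
have Ecd y : c < y < d -> ~ E 0%N y.
  by move=> ycd [m [x [xab yx]]]; apply: (abcd (n.+1 + m)%N x) => //; rewrite -yx.
have surj := transitive_surj cf tf.
have dense := @invariant_dense _ _ tf.
(* [cover_swaps] needs a missed point to the right of [z]; if []c, d[] lies to the left, the line is
   reflected. *)
exists z; have [zd|dz] := ltP z d.
  pose v := (Num.max z c + d) / 2.
  have vP : Num.max z c < v < d.
    have : Num.max z c < d by rewrite gt_max zd.
    by rewrite /v; lra.
  have [zv cv] : z < v /\ c < v by move: vP; rewrite gt_max => /andP[/andP[]].
  apply: (@cover_swaps f z (E 0%N) (E 1%N) v) => //.
  - by move=> P fP s t st stP s' t' st'; exact: (dense P s t s' t').
  - exact: Econv.
  - exact: Econv.
  - by apply: Ecd; lra.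
apply: swaps_opp; pose v := - ((c + d) / 2).
apply: (@cover_swaps _ (- z) (fun x => E 0%N (- x)) (fun x => E 1%N (- x)) v).
- move=> P fP s t st stP s' t' st'.
  have [||||y yst Py] := dense (fun x => P (- x)) (- t) (- s) (- t') (- s').
  + by move=> x /fP; rewrite opprK.
  + by lra.
  + by move=> x xst; apply: stP; lra.
  + by lra.
  + by exists (- y) => //; lra.
- by move=> y; have [x fx] := surj (- y); exists (- x); rewrite opprK fx opprK.
- by rewrite opprK fz.
- by move=> y; exact: E01.
- by move=> x; rewrite opprK; exact: f01.
- by move=> x; rewrite opprK; exact: f10.
- by move=> y t Ey yt; apply: Econv Ey _; case: yt => yt; [right|left]; lra.
- by move=> y t Ey yt; apply: Econv Ey _; case: yt => yt; [right|left]; lra.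
- by rewrite /v; lra.
- by apply: Ecd; rewrite /v; lra.
Qed.

End Structure.

(** * Horseshoes and the lower bound *)

Section Horseshoe.
Variable R : realType.
Implicit Types (f g : R -> R) (a b c d x y z p : R).

Lemma last_preimage f a u v : continuous f -> a <= u -> f a = v ->
  exists e, [/\ a <= e <= u, f e = v & forall x, e < x <= u -> f x != v].
Proof.
move=> cf au fa; pose S := [set x | a <= x <= u /\ f x = v].
have Sa : S a by split=> //; lra.
have Su : ubound S u by move=> x [xau _]; lra.
have supS : has_sup S by split; [exists a|exists u].
have Sle x : S x -> x <= sup S by move=> Sx; exact: ub_le_sup (ex_intro _ _ Su) _ Sx.
have supu : sup S <= u by apply: ge_sup => //; exists a.
have near_sup d : 0 < d -> exists2 x, S x & sup S - d < x <= sup S.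
  move=> d0; have [x Sx xd] := sup_adherent d0 supS; exists x => //.
  by rewrite xd Sle.
exists (sup S); split.
- by rewrite supu Sle.
- apply/eqP; rewrite eq_le !leNgt; apply/andP; split; apply/negP => fS.
    have [|d d0 Sd] := @continuous_itv _ f (sup S) v (f (sup S) + 1) cf; first lra.
    by have [x [_ fx] xS] := near_sup d d0; have := Sd x; rewrite fx; lra.
  have [|d d0 Sd] := @continuous_itv _ f (sup S) (f (sup S) - 1) v cf; first lra.
  by have [x [_ fx] xS] := near_sup d d0; have := Sd x; rewrite fx; lra.
- move=> x xS; apply/eqP => fx; have : x <= sup S.
    by apply: (Sle x); split=> //; have := Sle _ Sa; lra.
  lra.
Qed.

Lemma first_preimage f a u v : continuous f -> u <= a -> f a = v ->
  exists e, [/\ u <= e <= a, f e = v & forall x, u <= x < e -> f x != v].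
Proof.
move=> cf ua fa.
have [|||e [eau fe eP]] := @last_preimage (fun x => f (- x)) (- a) (- u) v.
- by move=> x; apply: continuous_comp (cf _); exact: opp_continuous.
- by lra.
- by rewrite opprK.
exists (- e); split=> //; first by lra.
by move=> x xe; have := eP (- x); rewrite opprK; apply; lra.
Qed.

(** * Fixed points and horseshoe of a transitive map of a half-line *)

Section HalfLine.
Variables (g : R -> R) (z : R).
Hypotheses (cg : continuous g) (gz : g z = z) (gh : forall x, z <= x -> z <= g x).
Hypothesis tg : forall a b c d, z <= a -> a < b -> z <= c -> c < d ->
  exists n x, [/\ (0 < n)%N, a < x < b & c < iter n g x < d].

Let cgid : continuous (fun x => g x - x).
Proof. by move=> t; apply: cvgB; [exact: cg|exact: cvg_id]. Qed.

Lemma halfline_invariant_dense (P : R -> Prop) a b c d : (forall x, P x -> P (g x)) ->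
  z <= a -> a < b -> (forall x, a < x < b -> P x) -> z <= c -> c < d ->
  exists2 y, c < y < d & P y.
Proof.
move=> Pg za ab abP zc cd; have [n [x [_ xab xcd]]] := tg za ab zc cd.
by exists (iter n g x) => //; elim: n {xcd} => [|n IHn]; [exact: abP|exact: Pg].
Qed.

Lemma segment_max b : z <= b -> exists2 t, z <= t <= b & forall x, z <= x <= b -> g x <= g t.
Proof.
move=> zb; have [t tzb tP] := @EVT_max _ g _ _ zb (continuous_subspaceT cg).
exists t; first by move: tzb; rewrite in_itv.
by move=> x xzb; apply: tP; rewrite in_itv.
Qed.

(** Without fixed points beyond [a], the sign of [g x - x] is constant there: if positive, [[a + 1,
    +oo[] is invariant; if negative, so is some segment [[z, M]]. *)
Lemma fixpoints_unbounded a : z <= a -> exists2 p, a < p & g p = p.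
Proof.
move=> za; apply: contrapT => h.
have nofix x : a < x -> g x != x by move=> ax; apply/eqP => gx; apply: h; exists x.
have [[x ax gx]|down] := pselect (exists2 x, a < x & x < g x).
  have up y : a < y -> y < g y.
    move=> ay; rewrite ltNge; apply/negP => gy.
    have [|w wxy gw] := @ivt _ (fun x => g x - x) y x 0 cgid; first lra.
    by suff /eqP : g w != w; [lra|apply: nofix; lra].
  have [||||||y] := @halfline_invariant_dense (fun x => a + 1 <= x) (a + 1) (a + 2) a (a + 1);
    try by move=> *; lra.
  by move=> y ya; have := up y; lra.
have {}down x : a < x -> g x <= x.
  by move=> ax; rewrite leNgt; apply/negP => gx; apply: down; exists x.
have [t zta tP] := segment_max za; pose M := Num.max a (g t) + 1.
have [aM tM] : a < M /\ g t < M.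
  by split; rewrite /M ltr_pwDr// le_max lexx ?orbT.
have [||||||y] := @halfline_invariant_dense (fun x => z <= x <= M) z M M (M + 1);
  try by move=> *; lra.
move=> x xM; have := @gh x; have [ax|xa] := ltP a x; first by have := down _ ax; lra.
by have := tP x; lra.
Qed.

(** Otherwise [[z, d]] would be invariant; [jump_down] excludes [[a, +oo[] likewise. *)
Lemma jump_up d : z < d -> g d = d -> exists2 x, z <= x < d & d < g x.
Proof.
move=> zd gd; apply: contrapT => h.
have [||||||y] := @halfline_invariant_dense (fun x => z <= x <= d) z d d (d + 1);
  try by move=> *; lra.
move=> x /andP[zx]; rewrite le_eqVlt => /predU1P[->|xd]; first by rewrite gd; lra.
rewrite gh//= leNgt; apply/negP => gx; apply: h; exists x => //; lra.
Qed.

Lemma jump_down a : z < a -> g a = a -> exists2 y, a < y & g y < a.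
Proof.
move=> za ga; apply: contrapT => h.
have [||||||y] := @halfline_invariant_dense (fun x => a <= x) a (a + 1) z a;
  try by move=> *; lra.
move=> x; rewrite le_eqVlt => /predU1P[<-|ax]; first by rewrite ga.
by rewrite leNgt; apply/negP => gx; apply: h; exists x.
Qed.

(* xm is the first point whose image is g x' and a the last fixed point before
   xm; d is the first fixed point after some y > a with g y < a. The point x is xm
   if d < g xm, and otherwise any point of [z, d[ with d < g x, which lies to the
   right of xm by the choice of xm. *)
Lemma horseshoe : exists a x y d,
  [/\ z < a, a < x, x < y, y < d & [/\ g a = a, g d = d, d < g x & g y < a]].
Proof.
have [b zb gb] := fixpoints_unbounded (lexx z).
have [t ztb tP] := segment_max (ltW zb).
(* [d0] exceeds the values of [g] on [[z, b]]; since the image of [xm] exceeds [d0], this forces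
   [xm] beyond [b], so that the fixed point [a] can be taken in [[b, xm]], away from [z]. *)
have [d0 d0P gd0] : exists2 d0, Num.max b (g t) < d0 & g d0 = d0.
  by apply: fixpoints_unbounded; rewrite le_max (ltW zb).
have {d0P}[bd0 td0] : b < d0 /\ g t < d0 by move: d0P; rewrite gt_max => /andP[].
have [x' zx' d0x'] := @jump_up d0 (lt_trans zb bd0) gd0.
have zx'' : z <= x' by lra.
have [xm [zxm gxm xmP]] := @first_preimage g x' z (g x') cg zx'' erefl.
have below x : z <= x -> g x' <= g x -> xm <= x.
  move=> zx gx; rewrite leNgt; apply/negP => xxm.
  have [|w wxx gw] := @ivt _ g z x (g x') cg; first by rewrite gz; lra.
  by suff /eqP : g w != g x'; [lra|apply: xmP; lra].
have bxm : b < xm by rewrite ltNge; apply/negP => xb; have := tP xm; lra.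
have [a [abxm ga aP]] : exists a,
    [/\ b <= a <= xm, g a - a = 0 & forall x, a < x <= xm -> g x - x != 0].
  by apply: last_preimage => //; [exact: ltW|rewrite gb subrr].
have axm : a < xm.
  by rewrite lt_neqAle; apply/andP; split; [apply/eqP => axm'; move: ga; rewrite axm'|]; lra.
have up x : a < x <= xm -> x < g x.
  move=> ax; rewrite ltNge; apply/negP => gx.
  have [|w wx gw] := @ivt _ (fun x => g x - x) x xm 0 cgid; first by lra.
  by suff /eqP : g w - w != 0; [lra|apply: aP; lra].
have [||y ay gy] := @jump_down a; [lra|lra|].
have xmy : xm < y by rewrite ltNge; apply/negP => yxm; have := up y; lra.
have [d' yd' gd'] : exists2 p, y < p & g p = p by apply: fixpoints_unbounded; lra.
have [d [dP gd dmin]] : exists d,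
    [/\ y <= d <= d', g d - d = 0 & forall x, y <= x < d -> g x - x != 0].
  by apply: first_preimage => //; [exact: ltW|rewrite gd' subrr].
have yd : y < d.
  by rewrite lt_neqAle; apply/andP; split; [apply/eqP => yd; move: gd; rewrite -yd|]; lra.
have down x : y <= x < d -> g x < x.
  move=> xyd; rewrite ltNge; apply/negP => gx.
  have [|w wx gw] := @ivt _ (fun x => g x - x) y x 0 cgid; first by lra.
  by suff /eqP : g w - w != 0; [lra|apply: dmin; lra].
have [za ga' gd''] : [/\ z < a, g a = a & g d = d] by split; lra.
have [dd1|d1d] := ltP d (g xm); first by exists a, xm, y, d.
have [||x zxd gx] := @jump_up d; [lra|lra|].
have xmx : xm <= x by apply: below; lra.
have xy : x < y by rewrite ltNge; apply/negP => yx; have := down x; lra.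
have ax : a < x by lra.
by exists a, x, y, d.
Qed.

(* A fourth branch, starting in the hole of the 3-horseshoe above the point x:
   the image of the hole is a right neighbourhood of the fixed point d, whose
   iterates grow until they reach below a, hence cover [a, d[. *)
Lemma extra_branch a x d : z < a -> a < x -> x < d -> g a = a -> g d = d -> d < g x ->
  exists m w1 w2, [/\ (1 < m)%N, a <= w1 <= x, a <= w2 <= x,
    iter m g w1 = a /\ iter m g w2 = g x &
    forall w, (w1 <= w <= w2) || (w2 <= w <= w1) -> d < g w].
Proof.
move=> za ax xd ga gd gx.
have [e1 [e1P ge1]] : exists e1, a <= e1 <= x /\ g e1 = d.
  have [|e1 e1P ge1] := @ivt _ g a x d cg; first by lra.
  by exists e1; split=> //; lra.
have [||e [e1x ge eP]] := @last_preimage g e1 x d cg; [lra|lra|].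
have above w : e < w <= x -> d < g w.
  move=> we; rewrite ltNge; apply/negP => gw.
  have [|t tw gt] := @ivt _ g w x d cg; first by lra.
  by suff /eqP : g t != d; [lra|apply: eP; lra].
(* An iterate fixes [d] and sends a point [p] of []d, g x[] below [a], so it maps [[d, p]] over
   [[a, d]]. *)
have [||||n [p [n0 pd pa]]] := @tg d (g x) z a; try lra.
have gdn : iter n g d = d by elim: (n) => //= k ->.
have cgn : continuous (iter n g) by exact: continuous_iter.
have pre v : a <= v < d -> exists2 p', d < p' < g x & iter n g p' = v.
  move=> vd; have [|p' pp' gp'] := @ivt _ (iter n g) p d v cgn; first by rewrite gdn; lra.
  exists p' => //; suff : p' != d by move/eqP; lra.
  by apply/eqP => p'd; move: gp'; rewrite p'd gdn; lra.
have pull p' : d < p' < g x -> exists2 w, e < w <= x & g w = p'.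
  move=> p'd; have [|w we gw] := @ivt _ g e x p' cg; first by lra.
  exists w => //; suff : w != e by move/eqP; lra.
  by apply/eqP => wE; move: gw; rewrite wE; lra.
(* From []d, g x[] this iterate reaches [a] and [x], but perhaps not [d]; one more application of
   [g] sends these to [a] and [g x > d]. With the first step out of [[a, d]] this gives
   [m = n + 2]. *)
have [|p1 /pull[w1 w1P gw1] gp1] := pre a; first lra.
have [|p2 /pull[w2 w2P gw2] gp2] := pre x; first lra.
exists n.+2, w1, w2; split; [by []|lra|lra| |].
  by rewrite /= -!iterS !iterSr gw1 gw2 -!iterSr /= gp1 gp2 ga.
by move=> w w12; apply: above; lra.
Qed.

End HalfLine.
End Horseshoe.

(** * Coding of points by words in inverse branches *)

Section Words.
Variables (R : realType) (I : finType) (f : R -> R) (k : nat) (J : set R) (e : R).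
Variable s : I -> R -> R.
Hypothesis sJ : forall i p, J p -> J (s i p) /\ iter k f (s i p) = p.
Hypothesis s_sep : forall i j p q, J p -> J q -> i != j ->
  exists2 t, (t < k)%N & e <= `|iter t f (s i p) - iter t f (s j q)|.

(** The first letter is applied last, so that iterating [f] in blocks of [k] reads the word from
    left to right and ends at [p]. *)
Let pull (w : seq I) p := foldr s p w.

Lemma pull_in w p : J p -> J (pull w p).
Proof. by move=> Jp; elim: w => //= i w /(sJ i)[]. Qed.

Lemma iter_pull w p : J p -> iter (size w * k) f (pull w p) = p.
Proof.
move=> Jp; elim: w => //= i w IHw.
by rewrite mulSn addnC iterD (sJ i (pull_in w Jp)).2.
Qed.

(** Once the common prefix has been read, the first distinct letters separate the orbits within one
    block. *)
Lemma pull_separated w w' p q : J p -> J q -> size w = size w' -> w != w' ->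
  exists2 t, (t < size w * k)%N & e <= `|iter t f (pull w p) - iter t f (pull w' q)|.
Proof.
move=> Jp Jq; elim: w w' => [|i w IHw] [|j w']//= [sww'].
have [Jw Jw'] := (pull_in w Jp, pull_in w' Jq).
rewrite eqseq_cons negb_and; have [<-{j} /= ww'|ij _] := eqVneq i j.
  have [t tk et] := IHw _ sww' ww'; exists (t + k)%N; first by rewrite mulSn addnC ltn_add2l.
  by rewrite !iterD (sJ i Jw).2 (sJ i Jw').2.
have [t tk et] := s_sep Jw Jw' ij; exists t => //.
by rewrite mulSn ltn_addr.
Qed.

End Words.

Section HorseshoeEntropy.
Variable R : realType.
Implicit Types (f g : R -> R) (a d e p : R).

Lemma iterates_bounded f a d k : continuous f -> a <= d ->
  exists M : R, forall j x, (j < k)%N -> a <= x <= d -> `|iter j f x| <= M.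
Proof.
move=> cf ad; elim: k => [|k [M MP]]; first by exists 0.
have ck : continuous (fun x => `|iter k f x|).
  by move=> x; apply: (continuous_comp (@continuous_iter _ f k cf x)); exact: norm_continuous.
have [t _ tP] := @EVT_max _ _ _ _ ad (continuous_subspaceT ck).
exists (Num.max M `|iter k f t|) => j x; rewrite ltnS leq_eqVlt le_max.
by case/predU1P => [->|/MP jM] xad; rewrite ?jM// tP ?orbT// in_itv.
Qed.

(** Words of length [n] give [#|I| ^ n] points separated up to time [n * k]. Basing them at the
    periodic point [p0] keeps their whole orbits in one compact invariant set. *)
Lemma horseshoe_entropy (I : finType) f k a d e p0 (s : I -> R -> R) :
  continuous f -> (0 < k)%N -> (0 < #|I|)%N -> 0 < e ->
  (forall i p, a <= p <= d -> a <= s i p <= d /\ iter k f (s i p) = p) ->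
  (forall i j p q, a <= p <= d -> a <= q <= d -> i != j ->
    exists2 t, (t < k)%N & e <= `|iter t f (s i p) - iter t f (s j q)|) ->
  a <= p0 <= d -> iter k f p0 = p0 ->
  ((ln #|I|%:R / k%:R)%:E <= line_entropy f)%E.
Proof.
move=> cf k0 I0 e0 sJ s_sep Jp0 p0k; pose J : set R := [set x | a <= x <= d].
have ad : a <= d by lra.
have [M MP] := iterates_bounded k cf ad.
(* [f] need not preserve [[a, d]], hence the set of points whose whole orbit obeys the bound [M]
   valid for times below [k] on [[a, d]]. *)
pose K : set R := [set x | forall n, `|iter n f x| <= M].
have inK x : (forall n, J (iter (n * k) f x)) -> K x.
  move=> xJ n; rewrite (divn_eq n k) addnC iterD; apply: MP; first exact: ltn_pmod.
  exact: xJ.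
have pullK w : K (foldr s p0 w).
  apply: inK; elim: w => [|i w IHw] n /=.
    have -> : iter (n * k) f p0 = p0; last by [].
    by elim: n => // n IHn; rewrite mulSn iterD IHn.
  have Jw : J (foldr s p0 w) by exact: (IHw 0%N).
  case: n => [|n]; first by case: (sJ i _ Jw).
  by rewrite mulSn addnC iterD (sJ i _ Jw).2; exact: IHw.
have cK : compact K.
  have -> : K = `[- M, M]%classic `&` \bigcap_n (iter n f @^-1` `[- M, M]%classic).
    apply/seteqP; split=> [x Kx|x [_ xM] n].
      split=> [|n _]; rewrite /preimage/= in_itv/= -ler_norml; [exact: (Kx 0%N)|exact: Kx].
    by have := xM n Logic.I; rewrite /preimage/= in_itv/= -ler_norml.
  apply: compact_closedI; first exact: segment_compact.
  apply: closed_bigI => n _; apply: preimage_closed; last exact: itv_closed.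
  by move=> x _; exact: continuous_iter.
have iK : invariant_compact (f : R^o -> R^o) K.
  split=> //; first by exists p0; exact: (pullK [::]).
  by move=> _ [x Kx <-] n; rewrite -iterSr; exact: Kx.
rewrite /line_entropy /CR_entropy ifT; last by apply/asboolP; exists K.
apply: (@le_trans _ _ (@htop R R^o f K)); last by apply: ereal_sup_ubound; exists K.
(* Half of [e], because Bowen separation is strict while that of the branches is not. *)
apply: (@htop_ge R R^o f K (e / 2)) => //; first by lra.
move=> n; pose x (w : n.-tuple I) : R^o := foldr s p0 w.
have sep w w' : w != w' -> e / 2 < @bowen_dist R R^o f (n * k) (x w) (x w').
  move=> ww'.
  have [|t] := @pull_separated R I f k J e s sJ s_sep w w' p0 p0 Jp0 Jp0 _ ww'.
    by rewrite !size_tuple.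
  rewrite size_tuple => tn et; apply: (@lt_le_trans _ _ e); first by lra.
  apply: le_trans et _; rewrite distrC -mdist_lineE.
  exact: (le_bigmax _ _ (Ordinal tn)).
have x_inj : injective x.
  move=> w w' xw; apply/eqP; apply: contraT => /sep; rewrite xw.
  rewrite ltNge => /negP; case; apply: bigmax_le; first by lra.
  by move=> i _; rewrite mdist_lineE subrr normr0; lra.
exists [fset x w | w in {: n.-tuple I}]%fset; split.
- by move=> _ /imfsetP[w _ ->]; exact: pullK.
- move=> _ _ /imfsetP[w _ ->] /imfsetP[w' _ ->] xw; apply: sep.
  by apply: contraNneq xw => ->.
- by rewrite card_imfset//= -cardE card_tuple.
Qed.

End HorseshoeEntropy.

(** * The strict lower bound *)

Section LowerBound.
Variable R : realType.
Implicit Types (f g : R -> R) (a d e p q x y z : R).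

Lemma swaps_iter f z n x : swaps f z -> z <= x ->
  if odd n then iter n f x <= z else z <= iter n f x.
Proof.
move=> [_ fge fle] zx; elim: n => //= n; case: (odd n) => /=; [exact: fle|exact: fge].
Qed.

(** Each of [[a, x]], [[x, y]], [[y, d]] carries a branch. Near [x] and [y] the values of [g] leave
    [[a, d]], so the branches keep away from these points, hence from each other. *)
Lemma three_branches g a x y d : continuous g ->
  a < x -> x < y -> y < d -> g a = a -> g d = d -> d < g x -> g y < a ->
  exists2 e, 0 < e & exists s : 'I_3 -> R -> R,
    (forall i p, a <= p <= d -> a <= s i p <= d /\ g (s i p) = p) /\
    (forall i j p q, a <= p <= d -> a <= q <= d -> i != j ->
      e <= `|s i p - s j q|).
Proof.
move=> cg ax xy yd ga gd gx gy.
have [|e1 e10 gx'] := @continuous_itv _ g x d (g x + 1) cg; first lra.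
have [|e2 e20 gy'] := @continuous_itv _ g y (g y - 1) a cg; first lra.
pose e := Num.min e1 e2.
have [ee1 ee2] : e <= e1 /\ e <= e2 by rewrite /e !ge_min !lexx orbT.
have e0 : 0 < e by rewrite lt_min e10 e20.
pose B (i : 'I_3) q := match val i with
  | 0%N => a <= q <= x | 1%N => x <= q <= y | _ => y <= q <= d end.
have br (ip : 'I_3 * R) : exists q, a <= ip.2 <= d -> B ip.1 q /\ g q = ip.2.
  (* The default value [0] outside [[a, d]] makes the relation total, as [choice] requires. *)
  case: ip => i p /=; have [pJ|] := pselect (a <= p <= d); last by exists 0.
  case: i => [[|[|[|//]]] i3]; rewrite /B /=.
  - by have [|q qP gq] := @ivt_le _ g a x p cg (ltW ax); [lra|exists q].
  - by have [|q qP gq] := @ivt_le _ g x y p cg (ltW xy); [lra|exists q].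
  - by have [|q qP gq] := @ivt_le _ g y d p cg (ltW yd); [lra|exists q].
have [s sP] := choice br.
have Bfar q : a <= g q <= d -> (q <= x - e \/ x + e <= q) /\ (q <= y - e \/ y + e <= q).
  move=> gq; split.
    have [qx|qx] := leP q (x - e1); first by left; lra.
    have [xq|xq] := leP (x + e1) q; first by right; lra.
    by have := gx' q; lra.
  have [qx|qx] := leP q (y - e2); first by left; lra.
  have [xq|xq] := leP (y + e2) q; first by right; lra.
  by have := gy' q; lra.
exists e => //; exists (fun i p => s (i, p)); split=> [i p pJ|i j p q pJ qJ].
  have [/= Bs gs] := sP (i, p) pJ; split=> //.
  by move: Bs; rewrite /B; case: (val i) => [|[|?]]; lra.
have [/= Bp gp] := sP (i, p) pJ; have [/= Bq gq] := sP (j, q) qJ.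
have := Bfar (s (i, p)); rewrite gp => /(_ pJ)[fp1 fp2].
have := Bfar (s (j, q)); rewrite gq => /(_ qJ)[fq1 fq2].
move: fp1 fp2 fq1 fq2 Bp Bq {gp gq}; move: (s (i, p)) (s (j, q)) => u v.
rewrite /B -(inj_eq val_inj) ler_normr.
case: i j => [[|[|[|//]]] i3] [[|[|[|//]]] j3] //= *; apply/orP;
  first [by left; lra|by right; lra].
Qed.

Lemma ln_sqrt3 : ln (Num.sqrt 3) = ln 3 / 2 :> R.
Proof.
have s3 : 0 < Num.sqrt 3 :> R by rewrite sqrtr_gt0.
have : ln (Num.sqrt 3 ^+ 2) = ln 3 :> R by rewrite sqr_sqrtr.
by rewrite lnXn// mulr2n => <-; lra.
Qed.

Lemma T'_line_entropy_gt f : T'_line R f -> ((ln (Num.sqrt 3))%:E < line_entropy f)%E.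
Proof.
move=> [cf ttf nbf]; have [z zf] := not_bitransitive_swaps cf ttf nbf.
have tf := (transitive_lineP f).1 ttf.
pose g := f \o f; have cg : continuous g by move=> x; exact: continuous_comp (cf _) (cf _).
have [fz fge fle] := zf.
have gz : g z = z by rewrite /g /= !fz.
have gh x : z <= x -> z <= g x by move=> zx; exact/fle/fge.
have tg a b c d : z <= a -> a < b -> z <= c -> c < d ->
    exists n x, [/\ (0 < n)%N, a < x < b & c < iter n g x < d].
  move=> za ab zc cd; have [n [x [n0 xab xcd]]] := tf a b c d ab cd.
  (* Odd iterates send the right half-line to the left one, so the time found is even. *)
  have := @swaps_iter f z n x zf; case: ifPn => on; first lra.
  move=> _; exists n./2, x; split=> //.
    by rewrite half_gt0; case: n n0 on {xcd} => [|[]].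
  by rewrite /g iter_comp2 halfK (negbTE on) subn0.
have [a [x [y [d [za ax xy yd [ga gd gx gy]]]]]] := horseshoe cg gz gh tg.
have ad : a <= d by lra.
have xd : x < d by lra.
have [m [w1 [w2 [m1 w1P w2P [gw1 gw2] wd]]]] := extra_branch cg tg za ax xd ga gd gx.
have [e e0 [s [sJ s_sep]]] := three_branches cg ax xy yd ga gd gx gy.
pose l := Num.min w1 w2; pose r := Num.max w1 w2.
have lr w : l <= w <= r -> (w1 <= w <= w2) || (w2 <= w <= w1).
  by rewrite /l /r; case: (ltP w1 w2) => _ ->; rewrite ?orbT.
have lr0 : l <= r by rewrite /l /r; case: (ltP w1 w2) => //; lra.
have [t tlr tmin] := EVT_min lr0 (continuous_subspaceT cg).
(* The least height of [g] above [d] between [w1] and [w2]; it separates the extra branch from the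
   others. *)
pose h := g t - d.
have h0 : 0 < h.
  have tlr' : l <= t <= r by move: tlr; rewrite in_itv.
  by have := wd t (lr t tlr'); rewrite /h; lra.
have brW p : exists q, a <= p <= d -> [/\ a <= q <= d, d + h <= g q & iter m g q = p].
  have [pJ|] := pselect (a <= p <= d); last by exists 0.
  have [|q qP gq] := @ivt _ (iter m g) w1 w2 p (@continuous_iter _ g m cg).
    by rewrite gw1 gw2; lra.
  exists q => _; split=> //; first by lra.
  have := tmin q; rewrite in_itv/= /h => gq'.
  suff : g t <= g q by lra.
  apply: gq'; rewrite /l /r ge_min le_max; lra.
have [sW sWP] := choice brW.
(* The branches of g^m: 3^m compositions of horseshoe branches, and one that
   leaves [a, d] at the first step. *)
pose S (i : option (m.-tuple 'I_3)) p := if i is Some w then foldr s p w else sW p.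
pose e' := Num.min e h.
have e'0 : 0 < e' by rewrite lt_min e0 h0.
have [e'e e'h] : e' <= e /\ e' <= h by rewrite /e' !ge_min !lexx orbT.
pose J : set R := [set p | a <= p <= d].
have sJ1 i p : J p -> J (s i p) /\ iter 1 g (s i p) = p by exact: sJ.
have s_sep1 i j p q : J p -> J q -> i != j ->
    exists2 t, (t < 1)%N & e <= `|iter t g (s i p) - iter t g (s j q)|.
  by move=> Jp Jq ij; exists 0%N => //; exact: s_sep.
have SJ i p : a <= p <= d -> a <= S i p <= d /\ iter m.*2 f (S i p) = p.
  move=> pJ; rewrite -iter_comp2 -/g; case: i => [w|] /=; last by case: (sWP _ pJ).
  split; first exact: (pull_in sJ1 w pJ).
  by have := iter_pull sJ1 w pJ; rewrite muln1 size_tuple.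
have gJ w p : a <= p <= d -> g (foldr s p (w : m.-tuple 'I_3)) <= d.
  move=> pJ; case: w => [[|i w] /= sw]; first by move: m1; rewrite -(eqP sw).
  have Jw : J (foldr s p w) by exact: (pull_in sJ1 w pJ).
  by have [_ ->] := sJ i _ Jw; move: Jw; rewrite /J/=; lra.
have S_sep i j p q : a <= p <= d -> a <= q <= d -> i != j ->
    exists2 t, (t < m.*2)%N & e' <= `|iter t f (S i p) - iter t f (S j q)|.
  (* At time 2, that is after one step of [g], the extra branch is at or above [d + h], whereas a
     point coded by a word is at most [d]. *)
  have mixed w p' q' : a <= p' <= d -> a <= q' <= d ->
      e' <= `|iter 2 f (S None p') - iter 2 f (S (Some w) q')|.
    move=> pJ qJ; have [_ gp _] := sWP _ pJ; have gq := gJ w _ qJ.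
    by rewrite ler_normr; apply/orP; left; move: gp gq; rewrite /g /=; lra.
  have m2 : (2 < m.*2)%N by rewrite -(@ltn_double 1) // in m1.
  move=> pJ qJ; case: i => [w|]; case: j => [w'|] // ww'.
  - have [|u] := pull_separated sJ1 s_sep1 pJ qJ _ ww'; first by rewrite !size_tuple.
    rewrite size_tuple muln1 => um eu; exists u.*2; first by rewrite ltn_double.
    by rewrite -!iter_comp2; exact: le_trans eu.
  - by exists 2 => //; rewrite distrC; exact: mixed.
  - by exists 2 => //; exact: mixed.
have k0 : (0 < m.*2)%N by rewrite double_gt0 ltnW.
have I0 : (0 < #|{: option (m.-tuple 'I_3)}|)%N by rewrite card_option.
have aJ : a <= a <= d by lra.
have aper : iter m.*2 f a = a by rewrite -iter_comp2; elim: (m) => //= k ->.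
have := @horseshoe_entropy R _ f m.*2 a d e' a S cf k0 I0 e'0 SJ S_sep aJ aper.
rewrite card_option card_tuple card_ord; apply: lt_le_trans.
rewrite lte_fin ln_sqrt3 -muln2 natrM invfM mulrA ltr_pM2r ?invr_gt0//.
have m0 : 0 < m%:R :> R by rewrite ltr0n ltnW.
rewrite ltr_pdivlMr// mulr_natr -lnXn// ltr_ln ?posrE ?exprn_gt0//.
by rewrite -natrX ltr_nat.
Qed.

End LowerBound.

(** * Maps of entropy close to the bound *)

Section Example.
Variables (R : realType) (L : R).
Hypothesis L3 : 3 < L.
Implicit Types (x y t p q u v w : R) (k i j : int).

(* zigzag has slope L on [k - c, k + c] and - L on [k + c, k + 1 - c], k : int; it
   maps [k, k + 1] onto [k - (L - 3) / 4, k + 1 + (L - 3) / 4]. *)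
Let c : R := (L + 1) / (4 * L).

Let L0 : 0 < L. Proof. by apply: lt_trans L3. Qed.

Let slope : [/\ 3 < L, L * c = (L + 1) / 4, 1 / 4 < c & c < 1 / 3].
Proof.
have l3 := L3; have Lc : L * c = (L + 1) / 4 by rewrite /c; field; rewrite gt_eqF.
by split; rewrite // -(ltr_pM2l L0) Lc; lra.
Qed.

(** On [[0, 1]] the slope is [L] up to [c], [- L] up to [1 - c], then [L] again; the end values [0]
    and [1] let the translates glue. *)
Let phi t : R := Num.max (Num.min (L * t) ((1 + L) / 2 - L * t)) (1 - L + L * t).

Definition zigzag x : R := (Num.floor x)%:~R + phi (x - (Num.floor x)%:~R).
Let G := zigzag.

Let phi_lip s t : s <= t -> `|phi t - phi s| <= L * (t - s).
Proof.
have [l3 Lc c4 c3] := slope.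
rewrite -(ler_pM2l L0) mulrBr ler_norml /phi; move: (L * s) (L * t) => a b ab.
case: (leP a ((1 + L) / 2 - a)) => h1; case: (leP b ((1 + L) / 2 - b)) => h2;
by case: (leP _ (1 - L + a)) => h3; case: (leP _ (1 - L + b)) => h4; lra.
Qed.

Let phi0 : phi 0 = 0.
Proof.
have [l3 Lc c4 c3] := slope; rewrite /phi mulr0.
case: (leP 0 ((1 + L) / 2 - 0)) => h1; case: (leP _ (1 - L + 0)) => h2; lra.
Qed.

Let phi1 : phi 1 = 1.
Proof.
have [l3 Lc c4 c3] := slope; rewrite /phi mulr1.
case: (leP L ((1 + L) / 2 - L)) => h1; case: (leP _ (1 - L + L)) => h2; lra.
Qed.

Let G_seg k x : k%:~R <= x <= k%:~R + 1 -> G x = k%:~R + phi (x - k%:~R).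
Proof.
have [l3 Lc c4 c3] := slope.
move=> /andP[kx]; rewrite le_eqVlt => /predU1P[->|xk]; last first.
  by rewrite /G /zigzag (@floor_def _ _ k)// intrD kx.
have -> : k%:~R + 1 = (k + 1)%:~R :> R by rewrite intrD.
rewrite /G /zigzag intrKfloor subrr intrD.
have -> : k%:~R + 1 - k%:~R = 1 :> R by ring.
by rewrite phi0 phi1 addr0.
Qed.

Let G_up k x : - c <= x - k%:~R <= c -> G x = k%:~R + L * (x - k%:~R).
Proof.
have [l3 Lc c4 c3] := slope.
move=> xk; have [h1 h2] : - (L * c) <= L * (x - k%:~R) /\ L * (x - k%:~R) <= L * c.
  by rewrite -mulrN !ler_pM2l//; lra.
have [kx|xk'] := leP k%:~R x.
  rewrite (@G_seg k); last by lra.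
  rewrite /phi; move: (L * (x - k%:~R)) h1 h2 => u h1 h2.
  by case: (leP u ((1 + L) / 2 - u)) => h3; case: (leP _ (1 - L + u)) => h4; lra.
rewrite (@G_seg (k - 1)); last by rewrite intrB; lra.
rewrite /phi intrB.
have -> : L * (x - (k%:~R - 1)) = L * (x - k%:~R) + L by ring.
move: (L * (x - k%:~R)) h1 h2 => u h1 h2.
case: (leP (u + L) ((1 + L) / 2 - (u + L))) => h3;
by case: (leP _ (1 - L + (u + L))) => h4; lra.
Qed.

Let G_down k x : c <= x - k%:~R <= 1 - c -> G x = k%:~R + (1 + L) / 2 - L * (x - k%:~R).
Proof.
have [l3 Lc c4 c3] := slope.
move=> xk; have h1 : L * c <= L * (x - k%:~R) by rewrite ler_pM2l//; lra.
have : L * (x - k%:~R) <= L * (1 - c) by rewrite ler_pM2l//; lra.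
rewrite [L * (1 - c)]mulrBr mulr1 => h2.
rewrite (@G_seg k); last by lra.
rewrite /phi; move: (L * (x - k%:~R)) h1 h2 => u h1 h2.
by case: (leP u ((1 + L) / 2 - u)) => h3; case: (leP _ (1 - L + u)) => h4; lra.
Qed.

Let G_cases x : exists k, - c <= x - k%:~R <= c \/ c <= x - k%:~R <= 1 - c.
Proof.
have [l3 Lc c4 c3] := slope.
have := floor_itv x; rewrite intrD; set k := Num.floor x => xk.
have [h1|h1] := leP (x - k%:~R) c; first by exists k; left; lra.
have [h2|h2] := leP (x - k%:~R) (1 - c); first by exists k; right; lra.
by exists (k + 1); left; rewrite intrD; lra.
Qed.

Let G_int k : G k%:~R = k%:~R.
Proof. by have [l3 Lc c4 c3] := slope; rewrite (@G_up k) subrr ?mulr0 ?addr0//; lra. Qed.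

Let G_lip x y : `|G x - G y| <= L * `|x - y|.
Proof.
have [l3 Lc c4 c3] := slope.
wlog yx : x y / y <= x.
  have [yx|/ltW xy] := leP y x; first exact.
  by rewrite distrC (distrC x); apply.
rewrite [X in L * X]ger0_norm ?subr_ge0//.
have := floor_itv y; rewrite intrD; set i := Num.floor y => iy.
have := floor_itv x; rewrite intrD; set j := Num.floor x => jx.
have [xi|ix] := leP x (i%:~R + 1).
  rewrite (@G_seg i x) ?(@G_seg i y); [|lra|lra].
  have -> : i%:~R + phi (x - i%:~R) - (i%:~R + phi (y - i%:~R)) =
    phi (x - i%:~R) - phi (y - i%:~R) by ring.
  by apply: le_trans (@phi_lip _ _ _) _; [lra|rewrite ler_pM2l//; lra].
have ij : i%:~R + 1 <= j%:~R :> R.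
  by rewrite -[1]/(1%:~R) -intrD ler_int -ltzD1 -(@ltr_int R) !intrD; lra.
have h1 : `|phi (x - j%:~R) - phi 0| <= L * (x - j%:~R - 0) by apply: phi_lip; lra.
have h2 : `|phi 1 - phi (y - i%:~R)| <= L * (1 - (y - i%:~R)) by apply: phi_lip; lra.
have h3 : j%:~R - i%:~R - 1 <= L * (j%:~R - i%:~R - 1) by rewrite ler_peMl; lra.
rewrite (@G_seg j x) ?(@G_seg i y); [|lra|lra].
by move: h1 h2 h3; rewrite phi0 phi1 !ler_norml; lra.
Qed.

Let G_odd x : G (- x) = - G x.
Proof.
have [l3 Lc c4 c3] := slope.
have [k [xk|xk]] := G_cases x.
  by rewrite (@G_up k x)// (@G_up (- k) (- x)) ?intrN; [ring|lra].
rewrite (@G_down k x)// (@G_down (- k - 1) (- x)) ?intrB ?intrN; last by lra.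
by field.
Qed.

Let cG : continuous G.
Proof.
move=> x; apply/cvgrPdist_lt => e e0; near=> y.
apply: le_lt_trans (@G_lip x y) _; rewrite mulrC -ltr_pdivlMr//.
near: y; apply: (@cvgr_dist_lt _ _ _ (nbhs x) _ id x) => //; exact: divr_gt0.
Unshelve. all: by end_near. Qed.

Let addlK (a t : R) : a + t - a = t.
Proof. by ring. Qed.

(** * Covering relations between segments under the zigzag map *)

Let covers p q u v := exists n, forall w, u <= w <= v -> exists2 x, p <= x <= q & iter n G x = w.

Let covers_trans p q u v p' q' : covers p q p' q' -> covers p' q' u v -> covers p q u v.
Proof.
move=> [n np] [m mp]; exists (m + n)%N => w /mp[x /np[y yP <-] xw].
by exists y => //; rewrite iterD.
Qed.

Let covers_sub p q u v u' v' : covers p q u' v' -> u' <= u -> v <= v' -> covers p q u v.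
Proof.
by move=> [n np] uu vv; exists n => w wP; apply: np; lra.
Qed.

Let covers_refl p q : covers p q p q.
Proof. by exists 0%N => w wpq; exists w. Qed.

Let covers_image p q u v x1 x2 : p <= x1 <= q -> p <= x2 <= q -> G x1 <= u -> v <= G x2 ->
  covers p q u v.
Proof.
move=> h1 h2 Gu Gv; exists 1%N => w wP.
have [|x xP Gx] := @ivt _ G x1 x2 w cG; first by lra.
by exists x => //; lra.
Qed.

(* Every lap has length at least 1 - 2 c, so one half of [p, q] lies in one lap. *)
Let lap_growth p q : p < q -> q - p <= 1 - 2 * c ->
  exists p' q', covers p q p' q' /\ L / 2 * (q - p) <= q' - p'.
Proof.
have [l3 Lc c4 c3] := slope.
move=> pq pqc; pose m := (p + q) / 2.
have mP : p <= m <= q by rewrite /m; lra.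
have ppq : p <= p <= q by lra.
have qpq : p <= q <= q by lra.
have half1 : L / 2 * (q - p) = L * m - L * p by rewrite /m; field.
have half2 : L / 2 * (q - p) = L * q - L * m by rewrite /m; field.
have [k [mk|mk]] := G_cases m.
  have [kp|pk] := leP (k%:~R - c) p.
    exists (G p), (G m); split; first exact: covers_image (lexx _) (lexx _).
    by rewrite half1 (@G_up k m)// (@G_up k p); lra.
  exists (G m), (G q); split; first exact: covers_image (lexx _) (lexx _).
  by rewrite half2 (@G_up k m)// (@G_up k q); lra.
have [kp|pk] := leP (k%:~R + c) p.
  exists (G m), (G p); split; first exact: covers_image (lexx _) (lexx _).
  by rewrite half1 (@G_down k m)// (@G_down k p); lra.
exists (G q), (G m); split; first exact: covers_image (lexx _) (lexx _).
by rewrite half2 (@G_down k m)// (@G_down k q); lra.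
Qed.

(** Segments of length at most [1 - 2 * c] grow by a factor at least [L / 2 > 3 / 2]; from length
    [1 - 2 * c], one more step gives [L / 2 - L * c = (L - 1) / 4 > 1 / 2]. *)
Let covers_half p q : p < q -> exists p' q', covers p q p' q' /\ 1 / 2 <= q' - p'.
Proof.
have [l3 Lc c4 c3] := slope => pq.
suff [p1 [q1 [cov1 len1]]] : exists p1 q1, covers p q p1 q1 /\ 1 - 2 * c <= q1 - p1.
  have [||p' [q' [cov' len']]] := @lap_growth p1 (p1 + (1 - 2 * c)); [lra|lra|].
  exists p', q'; split.
    by apply: covers_trans cov'; apply: covers_sub cov1 _ _; lra.
  have lenE : L / 2 * (p1 + (1 - 2 * c) - p1) = L / 2 - L * c by field.
  by move: len'; rewrite lenE; lra.
(* The linear bound [1 + n / 2] on geometric growth is enough for the Archimedean property. *)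
have iterate n : exists p1 q1, [/\ covers p q p1 q1, p1 < q1 &
    1 - 2 * c <= q1 - p1 \/ (q - p) * (1 + n%:R / 2) <= q1 - p1].
  elim: n => [|n [p1 [q1 [cov1 pq1 len1]]]].
    by exists p, q; split=> //; right; lra.
  have [big|small] := leP (1 - 2 * c) (q1 - p1); first by exists p1, q1; split=> //; left.
  have {}len1 : (q - p) * (1 + n%:R / 2) <= q1 - p1 by case: len1; lra.
  have [p2 [q2 [cov2 len2]]] := @lap_growth p1 q1 pq1 (ltW small).
  have grow : 3 / 2 * (q1 - p1) <= L / 2 * (q1 - p1) by rewrite ler_pM2r; lra.
  have n0 : 0 <= (q - p) * (n%:R : R) by rewrite mulr_ge0//; lra.
  exists p2, q2; split; [exact: covers_trans cov2|lra|right].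
  by rewrite -natr1; lra.
have pq0 : 0 <= 2 / (q - p) by rewrite divr_ge0//; lra.
have [p1 [q1 [cov1 _ len1]]] := iterate (Num.bound (2 / (q - p))).
exists p1, q1; split=> //; case: len1 => // len1.
have := archi_boundP pq0; rewrite ltr_pdivrMr ?subr_gt0// mulrC.
lra.
Qed.

(** Between consecutive integers, a segment of length at least [1 / 2] contains the fixed point
    [k + 1 / 2] and a turning point [k + c] or [k + 1 - c], whose images lie above [k + 1] and below
    [k] respectively. *)
Let covers_integer p q : 1 / 2 <= q - p ->
  exists u v k, [/\ covers p q u v, u < v & u <= k%:~R <= v].
Proof.
have [l3 Lc c4 c3] := slope => pq.
have := floor_itv p; rewrite intrD; set k := Num.floor p => kp.
have [kq|qk] := leP (k%:~R + 1) q.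
  by exists p, q, (k + 1); split; [exact: covers_refl|lra|rewrite intrD; lra].
have Gmid : G (k%:~R + 1 / 2) = k%:~R + 1 / 2.
  by rewrite (@G_down k) addlK; [field|lra].
have [qk'|qk'] := leP (k%:~R + 3 / 4) q.
  exists k%:~R, (k%:~R + 1 / 2), k; split; [|lra|lra].
  apply: (@covers_image _ _ _ _ (k%:~R + (1 - c)) (k%:~R + 1 / 2)); [lra|lra| |lra].
  rewrite (@G_down k) addlK; [|lra].
  by rewrite mulrBr mulr1 Lc; lra.
exists (k%:~R + 1 / 2), (k%:~R + 1), (k + 1); rewrite intrD; split; [|lra|lra].
apply: (@covers_image _ _ _ _ (k%:~R + 1 / 2) (k%:~R + c)); [lra|lra|lra|].
rewrite (@G_up k) addlK; [|lra].
by rewrite Lc; lra.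
Qed.

(** The fixed point [j] repels with factor [L > 3] up to the turning point [j + c], whose image is
    beyond [j + 1]. *)
Let push_right j s : 0 <= s -> exists2 x, j%:~R <= x <= j%:~R + s &
  j%:~R + Num.min 1 (3 * s) <= G x.
Proof.
have [l3 Lc c4 c3] := slope => s0; have [sc|cs] := leP s c.
  exists (j%:~R + s); first by lra.
  rewrite (@G_up j) addlK; last by lra.
  by rewrite lerD2l ge_min ler_wpM2r ?orbT// ltW.
exists (j%:~R + c); first by lra.
rewrite (@G_up j) addlK; last by lra.
by rewrite lerD2l ge_min Lc; apply/orP; left; lra.
Qed.

Let push_left i s : 0 <= s -> exists2 x, i%:~R - s <= x <= i%:~R &
  G x <= i%:~R - Num.min 1 (3 * s).
Proof.
move=> s0; have [x xP Gx] := @push_right (- i) s s0.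
by exists (- x); [move: xP|rewrite G_odd; move: Gx]; rewrite intrN; lra.
Qed.

Let covers_widen (i j : int) s1 s2 n : i%:~R <= j%:~R :> R -> 0 <= s1 -> 0 <= s2 ->
  covers (i%:~R - s1) (j%:~R + s2)
    (i%:~R - Num.min 1 (s1 * (1 + n%:R))) (j%:~R + Num.min 1 (s2 * (1 + n%:R))).
Proof.
move=> ij s10 s20; elim: n => [|n IHn].
  rewrite addr0 !mulr1; apply: covers_sub (@covers_refl _ _) _ _.
    by rewrite lerD2l lerN2 ge_min lexx orbT.
  by rewrite lerD2l ge_min lexx orbT.
have grow (s : R) : 0 <= s -> 0 <= Num.min 1 (s * (1 + n%:R)) /\
    Num.min 1 (s * (1 + n.+1%:R)) <= Num.min 1 (3 * Num.min 1 (s * (1 + n%:R))).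
  move=> s0; have sn : 0 <= s * n%:R by rewrite mulr_ge0.
  split; first by rewrite le_min ler01 mulr_ge0// addr_ge0.
  rewrite le_min ge_min lexx /= -natr1 ge_min.
  by case: (leP 1 (s * (1 + n%:R))) => h; apply/orP; [left|right]; lra.
have [t10 g1] := grow _ s10; have [t20 g2] := grow _ s20.
apply: (covers_trans IHn).
have [x1 x1P Gx1] := @push_left i _ t10; have [x2 x2P Gx2] := @push_right j _ t20.
by apply: (@covers_image _ _ _ _ x1 x2); lra.
Qed.

(** The truth values [0 < s1] and [0 < s2], read as numbers, treat together an end beyond its
    integer, which gains a full unit, and an end at its integer, which stays. *)
Let covers_unit (i j : int) s1 s2 : i%:~R <= j%:~R :> R -> 0 <= s1 -> 0 <= s2 ->
  covers (i%:~R - s1) (j%:~R + s2) (i%:~R - (0 < s1)%R%:R) (j%:~R + (0 < s2)%R%:R).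
Proof.
move=> ij s10 s20.
have large (s : R) : 0 <= s -> exists N, forall n, (N <= n)%N ->
    (0 < s)%R%:R <= Num.min 1 (s * (1 + n%:R)).
  move=> s0; exists (Num.bound s^-1) => n Nn.
  case: (ltP 0 s) => sP; last by rewrite le_min ler01 mulr_ge0// addr_ge0.
  rewrite le_min lexx /= mulrC -ler_pdivrMr// div1r.
  have /archi_boundP sN : 0 <= s^-1 by rewrite invr_ge0.
  have : (Num.bound s^-1)%:R <= n%:R :> R by rewrite ler_nat.
  by lra.
have [N1 N1P] := large _ s10; have [N2 N2P] := large _ s20.
have := N1P (maxn N1 N2) (leq_maxl _ _); have := N2P (maxn N1 N2) (leq_maxr _ _) => h2 h1.
by apply: covers_sub (@covers_widen i j s1 s2 (maxn N1 N2) ij s10 s20) _ _; lra.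
Qed.

(** Successive coverings: a segment of length [1 / 2], one containing an integer, a unit interval,
    then one more unit on each side at every stage, thanks to the overflow [(L - 3) / 4] of the
    extreme laps. *)
Let covers_all p q : p < q -> exists k, forall N, covers p q (k%:~R - N%:R) (k%:~R + N%:R).
Proof.
have [l3 Lc c4 c3] := slope => /covers_half[p1 [q1 [cov1 /covers_integer]]].
move=> [u [v [k [cov2 uv kuv]]]].
have [i cov3] : exists i, covers u v i%:~R (i%:~R + 1).
  have := @covers_unit k k (k%:~R - u) (v - k%:~R) (lexx _).
  have -> : k%:~R - (k%:~R - u) = u by lra.
  have -> : k%:~R + (v - k%:~R) = v by lra.
  have [ku|uk] := ltP 0 (k%:~R - u).
    have v0 := ler0n R (0 < v - k%:~R)%R.
    by move=> /= h; exists (k - 1); apply: covers_sub (h _ _) _ _; rewrite ?intrB; lra.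
  have -> : 0 < v - k%:~R by lra.
  by move=> /= h; exists k; apply: covers_sub (h _ _) _ _; lra.
exists i => N; apply: covers_trans cov1 _; apply: covers_trans cov2 _; apply: covers_trans cov3 _.
apply: (@covers_sub _ _ _ _ (i%:~R - N%:R) (i%:~R + 1 + N%:R)); [|lra|lra].
elim: N => [|n IHn]; first by rewrite subr0 addr0; exact: covers_refl.
apply: (covers_trans IHn).
pose i1 := i - n%:Z; pose j1 := i + 1 + n%:Z.
have i1E : i1%:~R = i%:~R - n%:R :> R by rewrite intrB.
have j1E : j1%:~R = i%:~R + 1 + n%:R :> R by rewrite !intrD.
rewrite -i1E -j1E.
have n0 : 0 <= n%:R :> R by [].
have s0 : 0 < (L - 3) / 4 by lra.
apply: (@covers_trans _ _ _ _ (i1%:~R - (L - 3) / 4) (j1%:~R + (L - 3) / 4)).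
  apply: (@covers_image _ _ _ _ (i1%:~R + (1 - c)) ((j1 - 1)%:~R + c)).
  - by lra.
  - by rewrite intrB; lra.
  - rewrite (@G_down i1) addlK; last by lra.
    by rewrite mulrBr mulr1 Lc; lra.
  - rewrite (@G_up (j1 - 1)) addlK; last by lra.
    by rewrite intrB Lc; lra.
have := @covers_unit i1 j1 _ _ _ (ltW s0) (ltW s0); rewrite s0 /= => h.
by apply: covers_sub (h _) _ _; rewrite -?natr1; lra.
Qed.

Lemma zigzag_transitive : interval_transitive zigzag.
Proof.
move=> a b u v ab uv; pose w := (u + v) / 2.
have [y Gy] : exists y, G y = w.
  have [|y _ Gy] := @ivt _ G (Num.floor w)%:~R (Num.floor w + 1)%:~R w cG; last by exists y.
  by rewrite !G_int; have := floor_itv w; lra.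
(* The middle third keeps [x] inside []a, b[]; aiming at a preimage [y] of [w] makes the time [n.+1]
   positive. *)
have [|k kN] := @covers_all ((2 * a + b) / 3) ((a + 2 * b) / 3); first lra.
have [n nP] := kN (Num.bound `|y - k%:~R|).
have [|x xP Gx] := nP y; last first.
  by exists n.+1, x; split=> //; [lra|rewrite iterS -/G Gx Gy /w; lra].
by have := archi_boundP (normr_ge0 (y - k%:~R)); rewrite ltr_norml; lra.
Qed.

(** * The folded zigzag map *)

Definition folded_zigzag x : R := if 0 <= x then - `|zigzag x| else - x.
Let f := folded_zigzag.

Let G_zero : G 0 = 0.
Proof. exact: (G_int 0). Qed.

Let f_neg x : x <= 0 -> f x = - x.
Proof.
rewrite le_eqVlt => /predU1P[->|x0]; last by rewrite /f /folded_zigzag leNgt x0.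
by rewrite /f /folded_zigzag lexx -/G G_zero normr0 oppr0.
Qed.

Lemma folded_zigzag0 : folded_zigzag 0 = 0.
Proof. by rewrite -/f f_neg// oppr0. Qed.

Let f_pos x : 0 <= x -> f x = - `|G x|.
Proof. by move=> x0; rewrite /f /folded_zigzag x0. Qed.

Let ff_pos x : 0 <= x -> f (f x) = `|G x|.
Proof. by move=> x0; rewrite f_neg f_pos ?opprK// oppr_le0. Qed.

Let G_norm x : `|G `|x| | = `|G x|.
Proof. by case: (ler0P x) => _ //; rewrite G_odd normrN. Qed.

(** [G] being odd, [|G|] is what [G] induces on the quotient by [x |-> - x], so iteration commutes
    with the absolute value. *)
Let iter_f_even n x : 0 <= x -> iter n.*2 f x = `|iter n G x|.
Proof.
move=> x0; elim: n => [|n IHn]; first by rewrite /= ger0_norm.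
by rewrite doubleS 2!iterS IHn ff_pos// G_norm.
Qed.

Let f_lip x y : `|f x - f y| <= L * `|x - y|.
Proof.
have [l3 _ _ _] := slope.
wlog yx : x y / y <= x.
  have [yx|/ltW xy] := leP y x; first exact.
  by rewrite distrC (distrC x); apply.
have G0 : `|G x| <= L * `|x|.
  by have := G_lip x 0; rewrite G_zero !subr0.
have [x0|x0] := leP 0 x; have [y0|y0] := leP 0 y.
- rewrite !f_pos// opprK addrC (le_trans _ (G_lip x y))//.
  by rewrite (distrC (G x)); exact: ler_dist_dist.
- rewrite f_pos// (f_neg (ltW y0)) opprK (ger0_norm (_ : 0 <= x - y)) ?subr_ge0//.
  have : - y <= L * - y by rewrite ler_peMl; lra.
  move: G0 (normr_ge0 (G x)); rewrite (ger0_norm x0); move: `|G x| => g.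
  by rewrite ler_norml; lra.
- lra.
- rewrite (f_neg (ltW x0)) (f_neg (ltW y0)) opprK addrC distrC ler_peMl//; lra.
Qed.

(** The constant is [L] and not [L ^+ 2], because one of the two steps is the isometry
    [x |-> - x]. *)
Let ff_lip x y : `|f (f x) - f (f y)| <= L * `|x - y|.
Proof.
have [l3 _ _ _] := slope.
have G0 t : `|G t| <= L * `|t|.
  by have := G_lip t 0; rewrite G_zero !subr0.
wlog yx : x y / y <= x.
  have [yx|/ltW xy] := leP y x; first exact.
  by rewrite distrC (distrC x); apply.
have ff_neg t : t <= 0 -> f (f t) = - `|G t|.
  by move=> t0; rewrite (f_neg t0) f_pos ?oppr_ge0// G_odd normrN.
have [x0|x0] := leP 0 x; have [y0|y0] := leP 0 y.
- by rewrite !ff_pos// (le_trans _ (G_lip x y))// ler_dist_dist.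
- rewrite ff_pos// (ff_neg _ (ltW y0)) opprK (ger0_norm (_ : 0 <= x - y)) ?subr_ge0//.
  move: (G0 x) (G0 y) (normr_ge0 (G x)) (normr_ge0 (G y)).
  rewrite (ger0_norm x0) (ltr0_norm y0); move: `|G x| `|G y| => g h.
  by rewrite ler_norml; lra.
- lra.
- rewrite (ff_neg _ (ltW x0)) (ff_neg _ (ltW y0)) opprK addrC (le_trans _ (G_lip x y))//.
  by rewrite (distrC (G x)); exact: ler_dist_dist.
Qed.

Lemma folded_zigzag_iter_lip n x y :
  `|iter n folded_zigzag x - iter n folded_zigzag y| <= L ^+ uphalf n * `|x - y|.
Proof.
suff even m : `|iter m.*2 f x - iter m.*2 f y| <= L ^+ m * `|x - y|.
  rewrite uphalf_half -/f -{1 2}(odd_double_half n); case: (odd n); last exact: even.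
  by rewrite !add1n !iterS exprS -mulrA (le_trans (f_lip _ _))// ler_pM2l.
elim: m => [|m IHm]; first by rewrite mul1r.
rewrite doubleS 4!iterS exprS -mulrA; apply: le_trans (ff_lip _ _) _.
by rewrite ler_pM2l.
Qed.

Lemma folded_zigzag_continuous : continuous folded_zigzag.
Proof.
move=> x; apply/cvgrPdist_lt => e e0; near=> y.
apply: le_lt_trans (@f_lip x y) _; rewrite mulrC -ltr_pdivlMr//.
near: y; apply: (@cvgr_dist_lt _ _ _ (nbhs x) _ id x) => //; exact: divr_gt0.
Unshelve. all: by end_near. Qed.

(** From the right half-line, even iterates reach positive targets as [|G ^ n|], odd ones negative
    targets as [- |G ^ n|]. From the left, the first step is the reflection. *)
Lemma folded_zigzag_transitive : interval_transitive folded_zigzag.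
Proof.
have from_right a b u v : 0 <= a -> a < b -> u < v ->
    exists n x, [/\ (0 < n)%N, a < x < b & u < iter n f x < v].
  move=> a0 ab uv; have [v0|v0] := ltP 0 v.
    have [|n [x [n0 xab xuv]]] := @zigzag_transitive a b (Num.max u 0) v ab.
      by rewrite gt_max uv.
    exists n.*2, x; split=> //; first by rewrite double_gt0.
    have x0 : 0 <= x by lra.
    move: xuv; rewrite gt_max iter_f_even// => /andP[/andP[h1 h2] h3].
    by rewrite ger0_norm ?h1// ltW.
  have [n [x [n0 xab xuv]]] := zigzag_transitive ab uv.
  case: n n0 xuv => // n _ xuv; exists n.*2.+1, x; split=> //.
  have x0 : 0 <= x by lra.
  by rewrite iterS iter_f_even// f_pos// G_norm -iterS ler0_norm ?opprK//; lra.
move=> a b u v ab uv; have [b0|b0] := ltP 0 b.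
  have a0 : 0 <= Num.max a 0 by rewrite le_max lexx orbT.
  have a0b : Num.max a 0 < b by rewrite gt_max ab.
  have [n [x [n0 xab xuv]]] := from_right _ _ _ _ a0 a0b uv.
  by exists n, x; split=> //; move: xab; rewrite gt_max; lra.
have [||n [x [n0 xab xuv]]] := from_right (- b) (- a) u v _ _ uv; [lra|lra|].
exists n.+1, (- x); split=> //; first lra.
by rewrite iterSr -/f f_neg ?opprK//; lra.
Qed.

Lemma folded_zigzag_in_T' : T'_line R folded_zigzag.
Proof.
split; first exact: folded_zigzag_continuous.
  by apply/transitive_lineP; exact: folded_zigzag_transitive.
rewrite /bitransitive_map => /transitive_lineP tff.
(* [f \o f] preserves [[0, +oo[], so []0, 1[] never reaches []-1, 0[]. *)
have [||n [x [n0 x01]]] := tff 0 1 (-1) 0; [lra|lra|].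
by rewrite iter_comp2 -/f iter_f_even; have := normr_ge0 (iter n G x); lra.
Qed.

End Example.

Lemma folded_zigzag_entropy_le (R : realType) (L : R) :
  3 < L -> (line_entropy (folded_zigzag L) <= (ln L / 2)%:E)%E.
Proof.
move=> L3; have L1 : 1 < L by lra.
have lip := folded_zigzag_iter_lip L3.
have [cf _ _] := folded_zigzag_in_T' L3.
rewrite /line_entropy /CR_entropy ifT; last first.
  (* The fixed point [0] is a compact invariant set, so the convention [+oo] does not apply. *)
  apply/asboolP; exists [set 0 : R^o]; split; first by exists 0.
    exact: compact_set1.
  by move=> _ [_ -> <-]; rewrite /= folded_zigzag0.
by apply: ge_ereal_sup => _ [K [_ cK _] <-]; exact: htop_line_le.
Qed.

Theorem theorem14 (R : realType) :
  ereal_inf [set line_entropy f | f in T'_line R] = (ln (Num.sqrt 3))%:E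
  /\ ~ (exists2 f : R -> R, T'_line R f & line_entropy f = (ln (Num.sqrt 3))%:E).
Proof.
split; last first.
  by move=> [f fT fE]; have := T'_line_entropy_gt fT; rewrite fE ltxx.
apply/eqP; rewrite eq_le; apply/andP; split; last first.
  by apply: le_ereal_inf_tmp => _ [f fT <-]; exact/ltW/T'_line_entropy_gt.
apply/lee_addgt0Pr => e e0.
(* With [L = 3 * expR (2 * e)], one has [ln L / 2 = ln 3 / 2 + e]. *)
have L3 : 3 < 3 * expR (2 * e) :> R by rewrite ltr_pMr// expR_gt1; lra.
have T'f := folded_zigzag_in_T' L3.
apply: (@le_trans _ _ (line_entropy (folded_zigzag (3 * expR (2 * e))))).
  by apply: ereal_inf_lbound; exists (folded_zigzag (3 * expR (2 * e))).
apply: le_trans (folded_zigzag_entropy_le L3) _.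
rewrite -EFinD lee_fin ln_sqrt3 lnM ?posrE ?expR_gt0// expRK.
by lra.
Qed.
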